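(* Let $G$ and $H$ be finite nonempty connected graphs each having at least one edge, $f\colon G\to H$ a graph homomorphism, $v\in V(G)$, $w=f(v)$, $\Gamma=\pi_1^2(G,v)$, $p_G\colon(\tilde G,\tilde v)\to(G,v)$ and $p_H\colon(\tilde H,\tilde w)\to(H,w)$ the universal 2-coverings, and $\tilde f\colon(\tilde G,\tilde v)\to(\tilde H,\tilde w)$ the based lift of $f$. If $\tilde H$ is a tree, then $\mathrm{Hom}^\Gamma(\tilde G,\tilde H)_{\tilde f}$ is contractible.
   Context: Graphs allow loops; $N(x)$ is the neighborhood and $N^2(x)=\bigcup_{y\in N(x)}N(y)$. $\pi_1^2(G,v)$: group (under concatenation) of classes of closed walks at $v$ under the equivalence generated by (A) $(x_0,\dots,x_m)\sim(x_0,\dots,x_k,y,x_k,\dots,x_m)$ with $y$ adjacent to $x_k$, and (B) equal-length walks differing in at most one position. A 2-covering map restricts to bijections $N(x)\to N(p(x))$ and $N^2(x)\to N^2(p(x))$ for all $x$; the universal 2-covering of $(G,v)$ is the connected based 2-covering with trivial 2-fundamental group. $\pi_1^2(G,v)$ acts on $\tilde G$ by: $g\tilde x$ is the endpoint of the lift starting at $\tilde v$ of $\gamma\cdot(p_G\circ\varphi)$, where $g=[\gamma]$ and $\varphi$ is a walk in $\tilde G$ from $\tilde v$ to $\tilde x$; similarly for $H$. $\Gamma$ acts on $\tilde H$ via $f_*$, and the based homomorphism $\tilde f$ with $p_H\circ\tilde f=f\circ p_G$ is $\Gamma$-equivariant. Multi-homomorphisms $\eta\colon V(\tilde G)\to\mathcal{P}(V(\tilde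 H))\setminus\{\emptyset\}$ (with $\eta(x)\times\eta(y)\subseteq E(\tilde H)$ for every edge $(x,y)$) form the poset $\mathrm{Hom}(\tilde G,\tilde H)$ under pointwise inclusion, topologized via the geometric realization of its order complex; $\tilde f$ is identified with $x\mapsto\{\tilde f(x)\}$. $\mathrm{Hom}^\Gamma(\tilde G,\tilde H)$ is the subposet of $\eta$ with $\eta(g\tilde x)=f_*(g)\eta(\tilde x)$, and $\mathrm{Hom}^\Gamma(\tilde G,\tilde H)_{\tilde f}$ its connected component containing $\tilde f$. *)

(* Defs.v *)
From HB Require Import structures.
From Stdlib Require Import Relation_Operators.
From mathcomp Require Import all_boot all_order all_algebra generic_quotient.
From mathcomp Require Import all_classical all_reals.
From mathcomp Require Import topology normedtype.
Import Order.TTheory GRing.Theory Num.Theory.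
Import numFieldNormedType.Exports.

Set Implicit Arguments.
Unset Strict Implicit.
Unset Printing Implicit Defensive.

Local Open Scope classical_set_scope.

(* Graphs may be infinite and may have loops. *)
Record graph := Graph {
  vertices :> choiceType;
  adj : rel vertices;
  adj_sym : symmetric adj }.

Arguments adj {g}.

Record graph_hom (G H : graph) := GraphHom {
  hom_fun :> G -> H;
  hom_adj : {homo hom_fun : x y / adj x y} }.

Definition nbr (G : graph) (x : G) : set G := [set y | adj x y].

Definition nbr2 (G : graph) (x : G) : set G := \bigcup_(y in nbr x) nbr y.

(* A walk x_0, x_1, ..., x_m is the pair of its origin x_0 and the sequence
   [:: x_1; ...; x_m]: it satisfies [path adj x_0 s] and ends at [last x_0 s].
   Concatenation of composable walks is then concatenation of sequences. *)

Definition connected_graph (G : graph) :=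
  forall x y : G, exists2 s, path adj x s & last x s = y.

(* [cycle adj [:: x]] is a loop at x, and a duplicate-free cyclic sequence of
   length 2 is a single edge traversed back and forth. *)
Definition acyclic_graph (G : graph) :=
  forall c : seq G, ucycle adj c -> size c = 0 \/ size c = 2.

Definition is_tree (G : graph) := connected_graph G /\ acyclic_graph G.

Section TwoFundamentalGroup.
Variables (G : graph) (v : G).

Definition closed_walk : pred (seq G) :=
  [pred s | path adj v s && (last v s == v)].

Definition loop := {s : seq G | closed_walk s}.

HB.instance Definition _ := [isSub of loop for sval].
HB.instance Definition _ := [Choice of loop by <:].

(* In a closed walk encoded as above the common origin [v] is not listed, and
   the common endpoint is [v] as well, so [moveB] only alters inner vertices. *)
Definition moveA (s t : loop) : Prop :=
  exists s1 s2 y, [/\ adj (last v s1) y, val s = s1 ++ s2 &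
    val t = s1 ++ [:: y, last v s1 & s2]].

Definition moveB (s t : loop) : Prop :=
  size (val s) = size (val t) /\
  exists i, forall j, j != i -> nth v (val s) j = nth v (val t) j.

Definition elementary (s t : loop) : Prop := moveA s t \/ moveB s t.

Definition homotopic : loop -> loop -> Prop := clos_refl_sym_trans loop elementary.

Definition homotopicb : rel loop := fun s t => `[< homotopic s t >].

Lemma homotopicb_refl : reflexive homotopicb.
Proof. by move=> s; apply/asboolP; exact: rst_refl. Qed.

Lemma homotopicb_sym : symmetric homotopicb.
Proof. by move=> s t; apply/asboolP/asboolP; exact: rst_sym. Qed.

Lemma homotopicb_trans : transitive homotopicb.
Proof.
move=> t s u /asboolP st /asboolP tu; apply/asboolP; exact: rst_trans st tu.
Qed.

Canonical homotopic_equiv :=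
  EquivRel homotopicb homotopicb_refl homotopicb_sym homotopicb_trans.

Definition pi2 := {eq_quot homotopic_equiv}%qT.
HB.instance Definition _ := Choice.on pi2.
HB.instance Definition _ := EqQuotient.on pi2.

Definition class_of (s : loop) : pi2 := (\pi_pi2 s)%qT.

Lemma class_ofP (s t : loop) : class_of s = class_of t <-> homotopic s t.
Proof.
by split=> [/eqquotP/asboolP|st]; [|apply/eqquotP/asboolP].
Qed.

Lemma class_of_repr (g : pi2) : class_of (repr g) = g.
Proof. exact: reprK. Qed.

Lemma class_of_surj (g : pi2) : exists s, g = class_of s.
Proof. by exists (repr g); rewrite class_of_repr. Qed.

Lemma loop_nilP : closed_walk [::]. Proof. by rewrite /closed_walk /= eqxx. Qed.
Definition loop_nil : loop := Sub [::] loop_nilP.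

Lemma loop_catP (s t : loop) : closed_walk (val s ++ val t).
Proof.
case: s t => [s /= /andP[sp /eqP sl]] [t /= /andP[tp /eqP tl]].
by rewrite /closed_walk /= cat_path sp last_cat sl tp tl eqxx.
Qed.
Definition loop_cat (s t : loop) : loop := Sub (val s ++ val t) (loop_catP s t).

Lemma loop_revP (s : loop) : closed_walk (rev (belast v (val s))).
Proof.
case: s => [s /= /andP[sp /eqP sl]]; apply/andP; split.
  rewrite /= -{1}sl rev_path; under eq_path do rewrite adj_sym; exact: sp.
by case: s sp sl => [|a s] //= _ _; rewrite rev_cons last_rcons.
Qed.
Definition loop_rev (s : loop) : loop :=
  Sub (rev (belast v (val s))) (loop_revP s).

Lemma homotopic_catl s s' t :
  homotopic s s' -> homotopic (loop_cat s t) (loop_cat s' t).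
Proof.
elim=> [{}s {}s' [[s1 [s2 [y [ay es et]]]]|[es [i ei]]]|?|????|?????? st].
- apply: rst_step; left; exists s1, (s2 ++ val t), y.
  by rewrite /= es et -!catA.
- apply: rst_step; right; rewrite /moveB /= !size_cat es; split=> //; exists i => j ji.
  by rewrite !nth_cat es ei.
- exact: rst_refl.
- exact: rst_sym.
- exact: rst_trans st.
Qed.

Lemma homotopic_catr s t t' :
  homotopic t t' -> homotopic (loop_cat s t) (loop_cat s t').
Proof.
elim=> [{}t {}t' [[s1 [s2 [y [ay es et]]]]|[es [i ei]]]|?|????|?????? st].
- apply: rst_step; left; exists (val s ++ s1), s2, y.
  have /andP[_ /eqP sl] := valP s.
  by rewrite /= es et -!catA last_cat sl.
- apply: rst_step; right; rewrite /moveB /= !size_cat es; split=> //.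
  exists (size (val s) + i)%N => j ji; rewrite !nth_cat; case: ltnP => // sj.
  by rewrite ei// -(eqn_add2l (size (val s))) subnKC.
- exact: rst_refl.
- exact: rst_sym.
- exact: rst_trans st.
Qed.

Lemma homotopic_cat s s' t t' : homotopic s s' -> homotopic t t' ->
  homotopic (loop_cat s t) (loop_cat s' t').
Proof.
move=> /(homotopic_catl t) st /(homotopic_catr s'); exact: rst_trans st.
Qed.

Lemma homotopic_catV s : homotopic (loop_cat s (loop_rev s)) loop_nil.
Proof.
suff main (p : seq G) (t : loop) : path adj v p ->
    val t = p ++ rev (belast v p) -> homotopic t loop_nil.
  by apply: (main (val s)) => //; case/andP: (valP s).
elim/last_ind: p t => [|p y IH] t.
  by move=> _ /= t0; rewrite (_ : t = loop_nil); [exact: rst_refl|exact: val_inj].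
rewrite rcons_path => /andP[pp py].
rewrite belast_rcons -cats1 -catA (lastI v p) rev_rcons /= => te.
have up : closed_walk (p ++ rev (belast v p)).
  have := valP t; rewrite /closed_walk /= te !cat_path /= !last_cat /=.
  by move=> /andP[/and4P[-> _ _ ->] ->].
apply: rst_trans (IH (Sub _ up) pp erefl).
by apply/rst_sym/rst_step; left; exists p, (rev (belast v p)), y.
Qed.

Lemma loop_revK s : loop_rev (loop_rev s) = s.
Proof.
apply: val_inj => /=; have /andP[_ /eqP] := valP s.
rewrite /=; elim/last_ind: (sval s) => //= t a _; rewrite last_rcons => ->.
by rewrite belast_rcons rev_cons belast_rcons rev_cons revK.
Qed.

Definition pi2_mul (g h : pi2) : pi2 := class_of (loop_cat (repr g) (repr h)).
Definition pi2_inv (g : pi2) : pi2 := class_of (loop_rev (repr g)).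

Lemma pi2_mulE s t :
  pi2_mul (class_of s) (class_of t) = class_of (loop_cat s t).
Proof.
by apply/class_ofP; apply: homotopic_cat; apply/class_ofP; rewrite class_of_repr.
Qed.

Lemma pi2_mulA : associative pi2_mul.
Proof.
move=> g h k; case: (class_of_surj g) (class_of_surj h) (class_of_surj k).
move=> s -> [t ->] [u ->]; rewrite !pi2_mulE; congr class_of.
by apply: val_inj; rewrite /= catA.
Qed.

Lemma pi2_mul1g : left_id (class_of loop_nil) pi2_mul.
Proof.
move=> g; case: (class_of_surj g) => s ->; rewrite pi2_mulE; congr class_of.
exact: val_inj.
Qed.

Lemma pi2_mulg1 : right_id (class_of loop_nil) pi2_mul.
Proof.
move=> g; case: (class_of_surj g) => s ->; rewrite pi2_mulE; congr class_of.
by apply: val_inj; rewrite /= cats0.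
Qed.

Lemma pi2_mulgV : right_inverse (class_of loop_nil) pi2_inv pi2_mul.
Proof.
move=> g; rewrite -[X in pi2_mul X]class_of_repr pi2_mulE.
by apply/class_ofP; exact: homotopic_catV.
Qed.

Lemma pi2_mulVg : left_inverse (class_of loop_nil) pi2_inv pi2_mul.
Proof.
move=> g; rewrite -[X in pi2_mul _ X]class_of_repr pi2_mulE.
rewrite -[X in loop_cat _ X]loop_revK.
by apply/class_ofP; exact: homotopic_catV.
Qed.

HB.instance Definition _ := isGroup.Build pi2
  pi2_mulA pi2_mul1g pi2_mulg1 pi2_mulVg pi2_mulgV.

End TwoFundamentalGroup.

Section InducedMap.
Variables (G H : graph) (f : graph_hom G H) (v : G).

Lemma loop_mapP (s : loop v) : closed_walk (f v) (map f (val s)).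
Proof.
case: s => [s /= /andP[sp /eqP sl]]; rewrite /closed_walk /= last_map sl eqxx andbT path_map.
by apply: sub_path sp => x y; exact: hom_adj.
Qed.
Definition loop_map (s : loop v) : loop (f v) :=
  Sub (map f (val s)) (loop_mapP s).

Definition pi2_map (g : pi2 v) : pi2 (f v) := class_of (loop_map (repr g)).

Lemma homotopic_map s t : homotopic s t -> homotopic (loop_map s) (loop_map t).
Proof.
elim=> [{}s {}t [[s1 [s2 [y [ay es et]]]]|[es [i ei]]]|?|????|?????? st].
- apply: rst_step; left; exists (map f s1), (map f s2), (f y).
  by rewrite last_map /= es et !map_cat /=; split=> //; exact: hom_adj.
- apply: rst_step; right; rewrite /moveB /= !size_map es; split=> //; exists i => j ji.
  case: (ltnP j (size (val t))) => jt; last by rewrite !nth_default ?size_map ?es.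
  by rewrite !(nth_map v) ?es// ei.
- exact: rst_refl.
- exact: rst_sym.
- exact: rst_trans st.
Qed.

Lemma pi2_mapE s : pi2_map (class_of s) = class_of (loop_map s).
Proof.
by apply/class_ofP/homotopic_map/class_ofP; rewrite class_of_repr.
Qed.

Lemma pi2_mapM : {morph pi2_map : g h / (g * h)%g}.
Proof.
move=> g h; case: (class_of_surj g) (class_of_surj h) => s -> [t ->].
rewrite [(_ * _)%g]pi2_mulE !pi2_mapE [RHS]pi2_mulE; congr class_of.
by apply: val_inj; rewrite /= map_cat.
Qed.

End InducedMap.

Definition two_covering (G' G : graph) (p : graph_hom G' G) :=
  forall x : G', set_bij (nbr x) (nbr (p x)) p /\
                 set_bij (nbr2 x) (nbr2 (p x)) p.

Definition universal_two_covering (G' G : graph) (p : graph_hom G' G)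
    (v' : G') (v : G) :=
  [/\ two_covering p, p v' = v, connected_graph G' &
      forall g : pi2 v', g = 1%g].

Section Action.
Variables (G' G : graph) (p : graph_hom G' G) (v' : G') (v : G).

(* [y] is the endpoint of a walk [psi] from [v'] that lifts the concatenation
   of a representative [gamma] of [g] with the projection of a walk [phi] from
   [v'] to [x]. When [p] is the universal 2-covering this set is a singleton. *)
Definition deck_endpoint (g : pi2 v) (x : G') : set G' :=
  [set y | exists (gamma : loop v) (phi psi : seq G'),
    [/\ class_of gamma = g, path adj v' phi /\ last v' phi = x,
        path adj v' psi, map p psi = val gamma ++ map p phi &
        last v' psi = y]].

Definition deck_act (g : pi2 v) (x : G') : G' := xget v' (deck_endpoint g x).

End Action.

Section MultiHom.
Variables G H : graph.

Definition multihom : set (G -> set H) :=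
  [set eta | (forall x, eta x !=set0) /\
     forall x y, adj x y -> forall a b, eta x a -> eta y b -> adj a b].

Definition multihom_le (eta theta : G -> set H) : Prop :=
  forall x, eta x `<=` theta x.

Definition multihom_of (f : G -> H) : G -> set H := fun x => [set f x].

End MultiHom.

Arguments multihom : clear implicits.
Arguments multihom_le : clear implicits.

Definition equiv_multihom (G H G' H' : graph) (f : graph_hom G H) (v : G)
    (pG : graph_hom G' G) (v' : G') (pH : graph_hom H' H) (w' : H') : set (G' -> set H') :=
  multihom G' H' `&`
  [set eta | forall (g : pi2 v) (x : G'),
     eta (deck_act pG v' g x) = deck_act pH w' (pi2_map f g) @` eta x].

Local Open Scope ring_scope.

(* A simplicial complex on [V] is given by the set of its simplices, each being
   a nonempty finite set of vertices. *)
Definition order_complex (P : choiceType) (le : P -> P -> Prop) (A : set P) :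
    set (set P) :=
  [set c | [/\ finite_set c, c !=set0, c `<=` A & total_on c le]].

Section Realization.
Variables (R : realType) (V : choiceType) (K : set (set V)).

Record realization := Realization {
  bary :> V -> R;
  bary_ge0 : forall u, 0 <= bary u;
  bary_supp : K [set u | bary u != 0];
  bary_sum : \sum_(u \in [set: V]) bary u = 1 }.

HB.instance Definition _ := gen_eqMixin realization.
HB.instance Definition _ := gen_choiceMixin realization.

Definition closed_simplex (c : set V) : set realization :=
  [set t | [set u | t u != 0] `<=` c].

(* [U] is open iff its trace on every closed simplex is open for the Euclidean
   topology of that simplex. *)
Definition weak_open (U : set realization) : Prop :=
  forall c, K c -> forall t, closed_simplex c t -> U t ->
    exists2 e : R, 0 < e & forall s, closed_simplex c s ->
      (forall u, c u -> `|s u - t u| < e) -> U s.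

Lemma weak_openT : weak_open setT.
Proof. by move=> c _ t _ _; exists 1. Qed.

Lemma weak_openI : setI_closed weak_open.
Proof.
move=> A B oA oB c Kc t ct [At Bt].
have [d d0 dA] := oA c Kc t ct At; have [e e0 eB] := oB c Kc t ct Bt.
exists (Num.min d e) => [|s cs st]; first by rewrite lt_min d0 e0.
by split; [apply: dA|apply: eB] => // u cu; have := st u cu;
   rewrite lt_min => /andP[].
Qed.

Lemma weak_open_bigU (I : Type) (F : I -> set realization) :
  (forall i, weak_open (F i)) -> weak_open (\bigcup_i F i).
Proof.
move=> oF c Kc t ct [i _ Fit]; have [e e0 eF] := oF i c Kc t ct Fit.
by exists e => // s cs st; exists i => //; exact: eF.
Qed.

HB.instance Definition _ := isOpenTopological.Build realization
  weak_openT weak_openI weak_open_bigU.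

Section Vertex.
Variables (a : V) (Ka : K [set a]).

Definition dirac_bary (u : V) : R := (u == a)%:R.

Lemma dirac_ge0 u : 0 <= dirac_bary u. Proof. exact: ler0n. Qed.

Lemma dirac_supp : K [set u | dirac_bary u != 0].
Proof.
rewrite (_ : [set _ | _] = [set a])//; apply/seteqP.
split=> u /=; rewrite /dirac_bary; last by move=> ->; rewrite eqxx oner_neq0.
by case: (eqVneq u a) => //; rewrite eqxx.
Qed.

Lemma dirac_sum : \sum_(u \in [set: V]) dirac_bary u = 1.
Proof.
rewrite -(fsbig_widen [set a] setT)// ?fsbig_set1 /dirac_bary ?eqxx//.
by move=> u [_ /= /eqP]; case: eqVneq.
Qed.

Definition vertex : realization := Realization dirac_ge0 dirac_supp dirac_sum.

End Vertex.
End Realization.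

Arguments vertex R {V K a}.

Lemma realization_openE (R : realType) (V : choiceType) (K : set (set V))
  (U : set (realization R K)) : open U = weak_open U.
Proof. by []. Qed.

(* Contractibility of the subspace [A], with respect to the unit interval of
   [R]. *)
Definition contractible (R : realType) (T : topologicalType) (A : set T) :=
  exists2 x0, A x0 & exists h : T * R -> T,
    [/\ {within A `*` `[0, 1], continuous h},
        h @` (A `*` `[0, 1]) `<=` A,
        forall x, A x -> h (x, 0) = x &
        forall x, A x -> h (x, 1) = x0].

(* Main.v *)
(** Let [T] be the tree covering [H].  A vertex [x] of the cover of [G] is rigid
    when it lies on a bi-infinite walk that [f'] maps to a geodesic line of [T];
    since [T] has no 4-cycle, every multihomomorphism in the component of [f']
    agrees with [f'] at the rigid vertices.  The poset [Q] of the equivariant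
    multihomomorphisms which do so, and whose values lie at even distance from
    those of [f'], is a union of components.

    A value [a] of [eta] at [x] is pulled back to [f' x] along the geodesic, two
    steps at a time.  A double step at [x] is obstructed only by a neighbour [y]
    with [f' y] the next vertex on the way from [f' x] to [a]; [y] has to move
    first.  Chains of obstructions are walks through non-rigid vertices with
    geodesic image.  As the action has finitely many orbits, a long chain would
    close up into a periodic one, whose vertices are rigid, so the chains have
    bounded length, and the length of the longest chain starting at [x] schedules
    the moves.  This gives monotone self-maps [retract n] of the poset, consecutive
    ones being comparable, that are constant equal to [f'] on [Q] for [n = 0] and
    eventually fix every element.  Running the homotopies between consecutive maps
    during the time intervals [[1/(n+2), 1/(n+1)]] contracts the realization of [Q];
    only finitely many of them move a given simplex, which is all that continuity
    for the weak topology requires. *)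
From Stdlib Require Import Relation_Operators.
Require Import Defs.
From mathcomp Require Import all_boot all_order all_algebra.
From mathcomp Require Import all_classical all_reals.
From mathcomp Require Import topology normedtype.
From mathcomp Require Import lra zify.
Import Order.TTheory GRing.Theory Num.Theory.
Import numFieldNormedType.Exports.
Local Open Scope classical_set_scope.

Set Implicit Arguments.
Unset Strict Implicit.
Unset Printing Implicit Defensive.

(** * The realization of an order complex *)

Section WeakTopology.
Local Open Scope ring_scope.
Variables (R : realType) (V : choiceType) (K : set (set V)).
Local Notation X := (realization R K).

Lemma realization_inj (s t : X) : bary s =1 bary t -> s = t.
Proof.
case: s t => [s s0 sK s1] [t t0 tK t1] /= /funext st; subst t.
by congr Realization; exact: Prop_irrelevance.
Qed.

Definition bsupp (t : X) : set V := [set u | t u != 0].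

(** Balls of a sup metric around [(t0, s0)], restricted to one closed simplex. *)
Definition simplex_nbhs (c : set V) (t0 : X) (s0 : R) : set_system (X * R) :=
  filter_from [set d : R | 0 < d] (fun d => [set z |
    [/\ closed_simplex c z.1, forall u, c u -> `|z.1 u - t0 u| < d &
        `|z.2 - s0| < d]]).

Global Instance simplex_nbhs_filter c t0 s0 : Filter (simplex_nbhs c t0 s0).
Proof.
apply: filter_from_filter; first by exists 1; rewrite /= ltr01.
move=> d e /= d0 e0; exists (Num.min d e); first by rewrite /= lt_min d0.
move=> [t s] /= [ct tt ss]; split; (split; [exact: ct| |]).
- by move=> u cu; move: (tt u cu); rewrite lt_min => /andP[].
- by move: ss; rewrite lt_min => /andP[].
- by move=> u cu; move: (tt u cu); rewrite lt_min => /andP[].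
- by move: ss; rewrite lt_min => /andP[].
Qed.

Lemma cvg_simplex_bary c t0 s0 u : closed_simplex c t0 ->
  (fun z : X * R => z.1 u) @ simplex_nbhs c t0 s0 --> (t0 u : R).
Proof.
move=> ct0; apply/cvgrPdist_lt => e e0; exists e => // -[t s] /= [ct tt _].
have [cu|ncu] := pselect (c u); first by rewrite distrC tt.
have z (x : X) : closed_simplex c x -> x u = 0.
  by move=> cx; apply/eqP/negPn/negP => xu; apply: ncu; exact: cx.
by rewrite !z// subrr normr0.
Qed.

Lemma cvg_simplex_time c t0 s0 :
  (fun z : X * R => z.2) @ simplex_nbhs c t0 s0 --> (s0 : R).
Proof.
apply/cvgrPdist_lt => e e0; exists e => // -[t s] /= [_ _ ss].
by rewrite distrC.
Qed.

(* [J] is a compact time interval: the points whose whole [J]-trajectory lies in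
   an open set form a weakly open set, by the tube lemma on every simplex. *)
Lemma continuous_of_simplexwise (Y : topologicalType) (h : X * R -> Y) :
  (forall c, K c -> forall t s, closed_simplex c t ->
     h z @[z --> simplex_nbhs c t s] --> h (t, s)) ->
  continuous h.
Proof.
move=> hc [t0 s0] U; rewrite nbhsE => -[U0 [oU0 U0h] U0U].
have Kt0 : K (bsupp t0) := bary_supp t0.
have ct0 : closed_simplex (bsupp t0) t0 by [].
have [d d0 dU] := hc _ Kt0 _ s0 ct0 _ (open_nbhs_nbhs (conj oU0 U0h)).
pose J : set R := `[s0 - d / 2, s0 + d / 2]%classic.
pose W := [set t : X | forall s, J s -> U0 (h (t, s))].
have oW : open W.
  rewrite realization_openE => c Kc t ct Wt.
  have /compact_near_coveringP cJ : compact J by exact: segment_compact.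
  pose P e s := forall t' : X, closed_simplex c t' ->
    (forall u, c u -> `|t' u - t u| < e) -> U0 (h (t', s)).
  have : \forall e \near 0^'+, J `<=` P e.
    apply: cJ => s Js.
    have [e /= e0 eU] := hc _ Kc _ s ct _ (open_nbhs_nbhs (conj oU0 (Wt _ Js))).
    exists (ball s e, [set x | 0 < x < e]) => /=; first split.
    - exact: nbhsx_ballx.
    - near=> x; apply/andP; split; near: x; [exact: nbhs_right_gt|exact: nbhs_right_lt].
    - move=> [s' x] /= [s's /andP[x0 xe]] t' ct' t't; apply: eU; split => //=.
        by move=> u cu; exact: lt_trans (t't u cu) xe.
      by rewrite distrC.
  move=> JP; have : \forall e \near (0:R)^'+, 0 < e /\ J `<=` P e.
    by near=> e; split; [near: e; exact: nbhs_right_gt|near: e].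
  move=> /filter_ex[e [e0 eP]]; exists e => // s cs st s' Js'; exact: eP.
exists (W, ball s0 (d / 2)) => /=; first split.
- apply: open_nbhs_nbhs; split=> // s; rewrite /J /= in_itv /= => /andP[s1 s2].
  apply: dU; split=> //= [u _|]; first by rewrite subrr normr0.
  have sd : `|s - s0| <= d / 2 by rewrite ler_distlC; lra.
  by apply: le_lt_trans sd _; move: d0 => /= d0; lra.
- by apply: nbhsx_ballx; move: d0 => /= d0; lra.
- move=> [t s] /= [Wt sb]; apply: U0U; apply: Wt; rewrite /J /= in_itv /=.
  by move: sb; rewrite /ball /= ltr_distlC; lra.
Unshelve. all: by end_near.
Qed.

(** [weak_open] grants a radius on each simplex separately. Only finitely many supports fit into
    [W], so a least radius exists and coordinatewise convergence suffices. *)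
Lemma cvg_realization (T : Type) (F : set_system T) (FF : Filter F)
    (W : seq V) (g : T -> X) (t : X) :
  (\forall z \near F, bsupp (g z) `<=` [set` W]) -> bsupp t `<=` [set` W] ->
  (forall u, u \in W -> g z u @[z --> F] --> (t u : R)) -> g @ F --> t.
Proof.
move=> gW tW gc U; rewrite nbhsE => -[U0 [oU0 U0t] U0U].
apply: (filterS U0U) => {U0U U}.
have near_t e : 0 < e -> \forall z \near F, forall u, u \in W -> `|t u - g z u| < e.
  move=> e0; elim: (W) gc => [|a l IH] gc; first by apply: nearW.
  have ha : \forall z \near F, `|t a - g z a| < e.
    by move: e e0 {IH}; apply/cvgrPdist_lt/gc; rewrite inE eqxx.
  have hl : \forall z \near F, forall u, u \in l -> `|t u - g z u| < e.
    by apply: IH => u ul; apply: gc; rewrite inE ul orbT.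
  near=> z => u; rewrite inE => /orP[/eqP ->|]; first by near: z.
  by move: u; near: z.
suff [e e0 eU] : exists2 e : R, 0 < e & forall s, bsupp s `<=` [set` W] ->
    (forall u, u \in W -> `|t u - s u| < e) -> U0 s.
  by apply: filterS2 gW (near_t e e0) => z gz zW; exact: eU.
pose P (m : seq V) (e : R) := forall s, bsupp s `<=` [set` W] -> bsupp s = [set` m] ->
  (forall u, u \in W -> `|t u - s u| < e) -> U0 s.
have [e e0 eP] : exists2 e : R, 0 < e &
    forall m, m \in [seq mask b W | b : (size W).-tuple bool] -> P m e.
  elim: [seq _ | b : _] => [|m l [e e0 eP]]; first by exists 1.
  suff [d d0 dP] : exists2 d : R, 0 < d & P m d.
    exists (Num.min d e); first by rewrite lt_min d0.
    move=> m'; rewrite inE => /orP[/eqP ->|m'l] s sW sm st.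
      by apply: dP => // u uW; move: (st u uW); rewrite lt_min => /andP[].
    by apply: (eP m') => // u uW; move: (st u uW); rewrite lt_min => /andP[].
  have [[Km ct]|nKc] := pselect (K [set` m] /\ closed_simplex [set` m] t).
    have [d d0 dU] := (oU0 : weak_open U0) _ Km t ct U0t.
    exists d => // s sW sm st; apply: dU; first by rewrite /closed_simplex /= -sm.
    by move=> u um; rewrite distrC; apply/st/sW; rewrite sm.
  (* Either [m] is no simplex and the claim is void, or some [w] in the support of [t] is not in
     [m]; then the radius [t w] excludes every point with support [m]. *)
  have [Km|nKm] := pselect (K [set` m]); last first.
    by exists 1 => // s _ sm _; case: nKm; rewrite -sm; exact: bary_supp.
  have [w [tw mw]] : exists w, bsupp t w /\ ~ [set` m] w.
    by apply: contra_notP nKc => /forallNP h; split=> // w tw;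
       apply: contrapT => mw; apply: (h w).
  have tw0 : 0 < t w by rewrite lt_neqAle eq_sym tw bary_ge0.
  exists (t w) => // s _ sm st; have := st w (tW _ tw).
  have /eqP -> : s w == 0 by apply: contra_notT mw; rewrite -sm.
  by rewrite subr0 gtr0_norm// ltxx.
exists e => // s sW st; apply: (eP [seq u <- W | s u != 0]) => //.
  rewrite filter_mask; apply/mapP.
  by exists (map_tuple (fun u => s u != 0) (in_tuple W)); rewrite ?mem_enum.
apply/seteqP; split=> u /=; rewrite mem_filter; last by case/andP.
by move=> su; rewrite su; exact: sW.
Unshelve. all: by end_near.
Qed.
End WeakTopology.

Section CvgMinMax.
Local Open Scope ring_scope.
Variables (R : realType) (T : Type) (F : set_system T).
Context {FF : Filter F}.

Lemma cvg_minr (f g : T -> R) (a b : R) : f @ F --> a -> g @ F --> b ->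
  Num.min (f x) (g x) @[x --> F] --> Num.min a b.
Proof.
move=> fa gb; under eq_fun do rewrite minr_absE.
rewrite minr_absE; apply: cvgM; last exact: cvg_cst.
by apply: cvgB; [exact: cvgD|apply: cvg_norm; exact: cvgB].
Qed.

Lemma cvg_maxr (f g : T -> R) (a b : R) : f @ F --> a -> g @ F --> b ->
  Num.max (f x) (g x) @[x --> F] --> Num.max a b.
Proof.
move=> fa gb; under eq_fun do rewrite maxr_absE.
rewrite maxr_absE; apply: cvgM; last exact: cvg_cst.
by apply: cvgD; [exact: cvgD|apply: cvg_norm; exact: cvgB].
Qed.

End CvgMinMax.

Lemma fsumT_seq (R : realType) (V : choiceType) (e : seq V) (f : V -> R) :
  uniq e -> (forall u, u \notin e -> f u = 0%R) ->
  (\sum_(u \in [set: V]) f u = \sum_(u <- e) f u)%R.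
Proof.
move=> ue f0; rewrite -(fsbig_widen [set` e] setT f)//=; last first.
  by move=> u [_ /= /negP]; exact: f0.
by rewrite -fsbig_seq.
Qed.

(** * Homotopies along a sequence of monotone maps *)

Section MonotoneSequence.
Local Open Scope ring_scope.
Variables (R : realType) (V : choiceType) (le : V -> V -> Prop) (A : set V).
Hypothesis leV_trans : forall v u w, le u v -> le v w -> le u w.
Hypothesis leV_anti : forall u v, le u v -> le v u -> u = v.
Local Notation K := (order_complex le A).
Local Notation X := (realization R K).

Variables (chi : nat -> V -> V) (up : nat -> bool) (thr : V -> nat).
Hypothesis chiA : forall n u, A u -> A (chi n u).
Hypothesis chi_mono : forall n u v, A u -> A v -> le u v -> le (chi n u) (chi n v).
Hypothesis chi_step : forall n u, A u ->
  if up n then le (chi n u) (chi n.+1 u) else le (chi n.+1 u) (chi n u).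
Hypothesis chi_stable : forall u n, (thr u <= n)%N -> chi n u = u.

(** The vertices [w] that have to move before [u] in stage [n]. *)
Definition beyond n : rel V := fun u w =>
  `[< u <> w /\ if up n then le u w else le w u >].

Lemma beyond_irr n u : beyond n u u = false.
Proof. by apply/asboolP => -[]. Qed.

Lemma beyond_trans n : transitive (beyond n).
Proof.
move=> v u w /asboolP[uv luv] /asboolP[vw lvw]; apply/asboolP.
case: (up n) luv lvw => luv lvw; split.
- by move=> uw; subst w; apply: uv; exact: leV_anti.
- exact: leV_trans luv lvw.
- by move=> uw; subst w; apply: uv; exact: leV_anti.
- exact: leV_trans lvw luv.
Qed.

(* The homotopy from [chi n] to [chi n.+1] crosses the prism over a chain: at time
   [tau] the part [tau] of the total mass that is topmost in the chain (bottommost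
   if [chi n.+1] is below [chi n]) has moved, which keeps the support a chain. *)
Definition mass n (t : V -> R) (tau : R) (u : V) : R :=
  Num.min (t u) (Num.max 0 (tau - \sum_(w \in [set: V]) (beyond n u w)%:R * t w)).

(* Goes from 1 to 0 while [s] increases from [1/(n+2)] to [1/(n+1)]. *)
Definition stage n (s : R) : R :=
  Num.max 0 (Num.min 1 (n.+2%:R * (1 - n.+1%:R * s))).

(* A telescoping sum, finite as [chi n u = u] from [thr u] on: at each time all the
   stages but one are 0 or 1. *)
Definition transport (t : V -> R) (s : R) (z u : V) : R :=
  t u * (chi 0 u == z)%:R +
  \sum_(n < thr u) mass n t (stage n s) u * ((chi n.+1 u == z)%:R - (chi n u == z)%:R).

Definition flow_bary (t : V -> R) (s : R) (z : V) : R :=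
  \sum_(u \in [set: V]) transport t s z u.

Lemma stage_le1 n s : stage n s <= 1.
Proof. by rewrite /stage ge_max ler01 ge_min lexx. Qed.

Lemma stage_at0 n : stage n 0 = 1.
Proof.
rewrite /stage mulr0 subr0 mulr1 min_l ?max_r ?ler01//.
by rewrite -[1]/(1%:R) ler_nat.
Qed.

Lemma stage_at1 n : stage n 1 = 0.
Proof.
rewrite /stage mulr1 max_l// ge_min pmulr_rle0 ?ltr0n// subr_le0.
by rewrite -[1]/(1%:R) ler_nat orbT.
Qed.

(** [stage m s < 1] means [s > 1/(m+2)], and the ramp of stage [n] has ended at
    [1/(n+1) <= 1/(m+2)]. *)
Lemma stage_eq0 m n s : (m < n)%N -> stage m s < 1 -> stage n s = 0.
Proof.
move=> mn; rewrite /stage gt_max ltr01 /= gt_min ltxx /= => ms.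
have ms1 : 1 < m.+2%:R * s.
  have m1 : (0:R) < m.+1%:R by rewrite ltr0n.
  rewrite -(ltr_pM2l m1) mulr1.
  have m2 : m.+2%:R = m.+1%:R + 1 :> R by rewrite -natr1.
  by move: ms; rewrite m2; lra.
apply: max_l; rewrite ge_min; apply/orP; right.
rewrite pmulr_rle0 ?ltr0n// subr_le0; apply/ltW/(lt_le_trans ms1).
have s0 : 0 < s by rewrite -(pmulr_rgt0 _ (_ : 0 < m.+2%:R :> R)) ?ltr0n// (lt_trans _ ms1).
by rewrite ler_pM2r// ler_nat.
Qed.

Section OnChain.
Variables (e : seq V) (t : V -> R).
Hypothesis e_uniq : uniq e.
Hypothesis t_ge0 : forall u, 0 <= t u.
Hypothesis t_supp : forall u, t u != 0 -> u \in e.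
Hypothesis t_sum : \sum_(u <- e) t u = 1.

Lemma massE n tau u : mass n t tau u =
  Num.min (t u) (Num.max 0 (tau - \sum_(w <- e) (beyond n u w)%:R * t w)).
Proof.
rewrite /mass (fsumT_seq e_uniq)// => w we.
by rewrite (_ : t w = 0) ?mulr0//; apply/eqP/(contraNT _ we)/t_supp.
Qed.

Lemma mass_ge0 n tau u : 0 <= mass n t tau u.
Proof. by rewrite /mass le_min t_ge0 le_max lexx. Qed.

Lemma mass_le n tau u : mass n t tau u <= t u.
Proof. by rewrite /mass ge_min lexx. Qed.

Lemma beyond_sum_ge0 n u : 0 <= \sum_(w <- e) (beyond n u w)%:R * t w.
Proof. by apply: sumr_ge0 => w _; apply: mulr_ge0. Qed.

Lemma mass0 n u : mass n t 0 u = 0.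
Proof.
rewrite massE; have h := beyond_sum_ge0 n u.
by rewrite sub0r max_l ?min_r ?t_ge0// oppr_le0.
Qed.

(** The total mass is 1 and [u] is not beyond itself, so at most [1 - t u] lies beyond it. *)
Lemma mass1 n u : u \in e -> mass n t 1 u = t u.
Proof.
move=> ue; rewrite massE min_l// le_max; apply/orP; right.
rewrite -[X in _ <= X - _]t_sum -sumrB (bigD1_seq u)//= beyond_irr mul0r subr0 lerDl.
apply: sumr_ge0 => w _; rewrite -[X in X - _]mul1r -mulrBl mulr_ge0// subr_ge0.
by case: beyond; [exact: lexx|exact: ler01].
Qed.

(** By transitivity the mass at [w] and beyond [w] lies beyond [u], and [tau] exceeds it once [u]
    has begun to move. *)
Lemma mass_beyond n tau u w : w \in e -> beyond n u w ->
  0 < mass n t tau u -> mass n t tau w = t w.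
Proof.
move=> we uw; rewrite !massE lt_min => /andP[_]; rewrite lt_max ltxx /= subr_gt0.
move=> h; rewrite min_l// le_max; apply/orP; right.
rewrite lerBrDr; apply: le_trans (ltW h).
rewrite [leRHS](bigD1_seq w)//= uw mul1r lerD2l.
rewrite (bigD1_seq w)//= beyond_irr mul0r add0r.
apply: ler_sum => x _; apply: ler_wpM2r => //.
case: (boolP (beyond n w x)) => // wx; first by rewrite (beyond_trans uw wx).
Qed.

(** Terms from [thr u] on vanish, so a common bound [N] gives the sum a fixed finite shape on a
    whole simplex. *)
Lemma flow_baryE N s z : (forall u, u \in e -> (thr u <= N)%N) ->
  flow_bary t s z = \sum_(u <- e) (t u * (chi 0 u == z)%:R +
    \sum_(n < N) mass n t (stage n s) u * ((chi n.+1 u == z)%:R - (chi n u == z)%:R)).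
Proof.
move=> eN; rewrite /flow_bary (fsumT_seq e_uniq); last first.
  move=> u ue; have tu : t u = 0 by apply/eqP/(contraNT _ ue)/t_supp.
  rewrite /transport tu mul0r add0r big1// => n _.
  have -> : mass n t (stage n s) u = 0; last by rewrite mul0r.
  by apply/le_anti/andP; rewrite mass_ge0 -[X in _ <= X]tu mass_le.
apply: eq_big_seq => u ue; congr (_ + _).
rewrite -(big_mkord xpredT (fun n =>
  mass n t (stage n s) u * ((chi n.+1 u == z)%:R - (chi n u == z)%:R))).
rewrite -(big_mkord xpredT (fun n =>
  mass n t (stage n s) u * ((chi n.+1 u == z)%:R - (chi n u == z)%:R))).
rewrite [RHS](big_cat_nat (n := thr u)) ?eN//=.
rewrite [X in _ = _ + X]big_nat [X in _ = _ + X]big1 ?addr0// => n /andP[un _].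
by rewrite !chi_stable ?subrr ?mulr0// ltnW.
Qed.

(** The stages before [m] are at 1 and telescope to [chi m], the relevant later ones are at 0, and
    only stage [m] can be in progress. *)
Lemma flow_bary_stage s : exists m tau, forall z, flow_bary t s z =
  \sum_(u <- e) ((t u - mass m t tau u) * (chi m u == z)%:R +
                 mass m t tau u * (chi m.+1 u == z)%:R).
Proof.
pose N := \max_(u <- e) thr u.
have eN u : u \in e -> (thr u <= N.+1)%N by move=> ue; apply: leqW; exact: leq_bigmax_seq.
have [m [mN m1 m0]] : exists m, [/\ (m <= N)%N, forall n, (n < m)%N -> stage n s = 1 &
    forall n, (m < n <= N)%N -> stage n s = 0].
  (* The first stage below 1, or [N] if no earlier one is; the bound [N.+1] keeps the index [N]
     inside the sum. *)
  have exm : exists m, (stage m s < 1) || (m == N) by exists N; rewrite eqxx orbT.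
  case: (ex_minnP exm) => m mP mmin; exists m; split.
  - by apply: mmin; rewrite eqxx orbT.
  - move=> n nm; apply/eqP; rewrite eq_le stage_le1 /= leNgt; apply/negP => ns.
    by have := mmin n; rewrite ns /= leqNgt nm => /(_ isT).
  - move=> n /andP[mn nN]; case/orP: mP => [ms|/eqP mN']; first exact: stage_eq0 mn ms.
    by move: mn; rewrite mN' ltnNge nN.
exists m, (stage m s) => z; rewrite (flow_baryE _ _ eN); apply: eq_big_seq => u ue.
rewrite -(big_mkord xpredT (fun n =>
  mass n t (stage n s) u * ((chi n.+1 u == z)%:R - (chi n u == z)%:R))).
rewrite (big_cat_nat (n := m)) ?leqW//= [X in _ + (_ + X)]big_ltn//=.
rewrite [X in _ + (_ + (_ + X))]big_nat [X in _ + (_ + (_ + X))]big1 ?addr0; last first.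
  by move=> n nN; rewrite m0 ?mass0 ?mul0r.
rewrite (eq_big_nat _ _
  (F2 := fun n => t u * (chi n.+1 u == z)%:R - t u * (chi n u == z)%:R)); last first.
  by move=> n /= nm; rewrite m1// mass1// mulrBr.
rewrite telescope_sumr//; lra.
Qed.

End OnChain.

Section Flow.
Variables (t : X) (s : R).
Let e : seq V := finmap.enum_fset (fset_set (bsupp t)).

Let e_uniq : uniq e. Proof. exact: finmap.fset_uniq. Qed.

Let mem_e u : (u \in e) = (t u != 0).
Proof.
have [fin_t _ _ _] := bary_supp t.
by rewrite /e in_fset_set//; apply/idP/idP => [/set_mem|tu]; last exact/mem_set.
Qed.

Let t_ge0 u : 0 <= t u. Proof. exact: bary_ge0. Qed.

Let t_supp u : t u != 0 -> u \in e. Proof. by rewrite mem_e. Qed.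

Let t_sum : \sum_(u <- e) t u = 1.
Proof.
rewrite -(bary_sum t) (fsumT_seq e_uniq)// => u; rewrite mem_e => /negPn/eqP ->//.
Qed.

Lemma flow_bary_repr : exists m tau,
  [/\ forall z, flow_bary t s z =
        \sum_(u <- e) ((t u - mass m t tau u) * (chi m u == z)%:R +
                       mass m t tau u * (chi m.+1 u == z)%:R),
      forall z, flow_bary t s z != 0 -> exists2 u, t u != 0 &
        (mass m t tau u < t u /\ z = chi m u) \/ (0 < mass m t tau u /\ z = chi m.+1 u) &
      forall u w, t u != 0 -> t w != 0 -> 0 < mass m t tau u -> mass m t tau w < t w ->
        beyond m u w = false].
Proof.
have [m [tau fE]] := flow_bary_stage e_uniq t_ge0 t_supp t_sum s.
exists m, tau; split=> // [z|u w tu tw mu mw].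
  rewrite fE; apply: contra_neqP => nu; rewrite big_seq big1// => u ue.
  have tu : t u != 0 by rewrite -mem_e.
  have m0 : 0 <= mass m t tau u by exact: mass_ge0.
  have m1 : mass m t tau u <= t u by exact: mass_le.
  have -> : (t u - mass m t tau u) * (chi m u == z)%:R = 0.
    case: eqVneq => [uz|]; last by rewrite mulr0.
    rewrite mulr1; apply/eqP; rewrite subr_eq0 eq_le m1 andbT leNgt; apply/negP => lt.
    by apply: nu; exists u => //; left.
  have -> : mass m t tau u * (chi m.+1 u == z)%:R = 0; last by rewrite addr0.
  case: eqVneq => [uz|]; last by rewrite mulr0.
  rewrite mulr1; apply/eqP; rewrite eq_le m0 andbT leNgt; apply/negP => lt.
  by apply: nu; exists u => //; right.
apply/negP => uw; move: mw.
by rewrite (mass_beyond e_uniq t_ge0 t_supp _ uw mu) ?ltxx// mem_e.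
Qed.

Lemma flow_bary_ge0 z : 0 <= flow_bary t s z.
Proof.
have [m [tau [-> _ _]]] := flow_bary_repr; apply: sumr_ge0 => u _.
have m0 : 0 <= mass m t tau u by exact: mass_ge0.
  have m1 : mass m t tau u <= t u by exact: mass_le.
by rewrite addr_ge0// mulr_ge0// subr_ge0.
Qed.

Lemma flow_bary_sum : \sum_(z \in [set: V]) flow_bary t s z = 1.
Proof.
have [m [tau [fE _ _]]] := flow_bary_repr.
have delta (W : seq V) a x : uniq W -> x \in W -> \sum_(z <- W) a * (x == z)%:R = a :> R.
  move=> uW xW; rewrite (bigD1_seq x)//= eqxx mulr1 big1 ?addr0// => z zx.
  by rewrite eq_sym (negPf zx) mulr0.
pose W := undup (map (chi m) e ++ map (chi m.+1) e).
rewrite (fsumT_seq (undup_uniq _ : uniq W)); last first.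
  move=> z zW; rewrite fE big_seq big1// => u ue.
  move: zW; rewrite mem_undup mem_cat negb_or => /andP[z1 z2].
  have -> : (chi m u == z) = false by apply: contraNF z1 => /eqP <-; exact: map_f.
  have -> : (chi m.+1 u == z) = false by apply: contraNF z2 => /eqP <-; exact: map_f.
  by rewrite !mulr0 addr0.
under eq_bigr do rewrite fE.
rewrite exchange_big -[RHS]t_sum /=; apply: eq_big_seq => u ue.
rewrite big_split /= !delta ?undup_uniq// ?mem_undup ?mem_cat ?map_f ?orbT//.
by rewrite subrK.
Qed.

Lemma flow_bary_supp : K [set z | flow_bary t s z != 0].
Proof.
have [fin_t _ tA tot] := bary_supp t.
have [m [tau [_ fsupp fbey]]] := flow_bary_repr; split.
- apply: (@sub_finite_set _ _ (chi m @` bsupp t `|` chi m.+1 @` bsupp t)).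
    by move=> z /= /fsupp[u tu [[_ ->]|[_ ->]]]; [left|right]; exists u.
  by rewrite finite_setU; split; exact: finite_image.
- apply: contrapT => /nonemptyPn s0; have := flow_bary_sum.
  rewrite fsbig1; first by move=> /esym/eqP; rewrite oner_eq0.
  move=> z _; apply/eqP/negPn/negP => fz.
  by have : [set z | flow_bary t s z != 0] z by []; rewrite s0.
- by move=> z /= /fsupp[u /tA Au [[_ ->]|[_ ->]]]; exact: chiA.
(* A moved image against an unmoved one: [w] is not beyond [u], so on the chain it lies on the other
   side of [u], and [chi_step] extends the inequality. *)
have cross u w : t u != 0 -> t w != 0 -> 0 < mass m t tau u -> mass m t tau w < t w ->
    le (chi m.+1 u) (chi m w) \/ le (chi m w) (chi m.+1 u).
  move=> tu tw mu mw; have := fbey _ _ tu tw mu mw.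
  have := chi_step m (tA _ tu); have {}tot := tot _ _ tu tw.
  rewrite /beyond; case: (up m) => le_u /asboolPn nb; [right|left].
    apply: leV_trans le_u; apply: chi_mono; [exact: tA|exact: tA|].
    case: tot => // uw; apply: contrapT => nwu; apply: nb; split=> // uw'.
    by subst w; apply: nwu.
  apply: leV_trans le_u _; apply: chi_mono; [exact: tA|exact: tA|].
  case: tot => // uw; apply: contrapT => nwu; apply: nb; split=> // uw'.
  by subst w; apply: nwu.
have mono n u w : t u != 0 -> t w != 0 -> le (chi n u) (chi n w) \/ le (chi n w) (chi n u).
  move=> tu tw; have Au := tA _ tu; have Aw := tA _ tw.
  by case: (tot _ _ tu tw) => uw; [left|right]; exact: chi_mono.
move=> x y /= /fsupp[u tu ux] /fsupp[w tw wy].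
case: ux wy => -[mu ->] [] [mw ->].
- exact: mono.
- by case: (cross w u); auto.
- exact: cross.
- exact: mono.
Qed.

(** All stages are at 1, and the sum telescopes to [chi (thr u) u = u]. *)
Lemma flow_bary_at0 z : flow_bary t 0 z = t z.
Proof.
have tr u : transport t 0 z u = t u * (u == z)%:R.
  rewrite /transport.
  have m1 n : mass n t (stage n 0) u = t u.
    rewrite stage_at0; have [ue|ue] := boolP (u \in e).
      exact: (mass1 e_uniq t_ge0 t_supp t_sum).
    have tu : t u = 0 by apply/eqP/(contraNT _ ue)/t_supp.
    by apply/eqP; rewrite eq_le mass_le tu mass_ge0.
  under eq_bigr do rewrite m1 mulrBr.
  rewrite -(big_mkord xpredT (fun n => t u * (chi n.+1 u == z)%:R - t u * (chi n u == z)%:R)).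
  by rewrite telescope_sumr// (chi_stable (leqnn _)) addrC subrK.
rewrite /flow_bary; under eq_fsbigr do rewrite tr.
rewrite (@fsumT_seq _ _ [:: z]) ?big_seq1 ?eqxx ?mulr1//.
by move=> u; rewrite inE => /negPf ->; rewrite mulr0.
Qed.

Lemma flow_bary_at1 z :
  flow_bary t 1 z = \sum_(u \in [set: V]) t u * (chi 0 u == z)%:R.
Proof.
apply: eq_fsbigr => u _; rewrite /transport big1 ?addr0// => n _.
by rewrite stage_at1 (mass0 e_uniq t_ge0 t_supp) mul0r.
Qed.

Definition flow : X := Realization flow_bary_ge0 flow_bary_supp flow_bary_sum.

End Flow.

Lemma flow_at0 t : flow t 0 = t.
Proof. by apply: realization_inj => z; exact: flow_bary_at0. Qed.

Lemma cvg_stage n (s : R) : stage n x @[x --> s] --> stage n s.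
Proof.
apply: cvg_maxr; first exact: cvg_cst.
apply: cvg_minr; first exact: cvg_cst.
apply: cvgM; first exact: cvg_cst.
apply: cvgB; first exact: cvg_cst.
by apply: cvgM; [exact: cvg_cst|exact: cvg_id].
Qed.

(** On a closed simplex the flow is a finite expression in sums, products, minima and maxima of the
    coordinates and the stages, and its values are supported in one finite set [W]. *)
Lemma flow_continuous : continuous (fun z : X * R => flow z.1 z.2).
Proof.
apply: continuous_of_simplexwise => c [fin_c _ cA ctot] t s ct.
pose e : seq V := finmap.enum_fset (fset_set c).
have e_uniq : uniq e by exact: finmap.fset_uniq.
have mem_e u : (u \in e) <-> c u.
  by rewrite /e in_fset_set//; split => [/set_mem|cu]; last exact/mem_set.
have supp_e (x : X) : closed_simplex c x -> forall u, x u != 0 -> u \in e.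
  by move=> cx u xu; apply/mem_e; exact: cx.
pose N := \max_(u <- e) thr u.
have eN u : u \in e -> (thr u <= N)%N by move=> ue; exact: leq_bigmax_seq.
pose W := e ++ [seq chi n u | n <- iota 0 N.+1, u <- e].
have chiW u n : u \in e -> chi n u \in W.
  move=> ue; rewrite mem_cat; have [nN|Nn] := leqP n N.
    by apply/orP; right; apply/allpairsP; exists (n, u); rewrite mem_iota.
  by rewrite chi_stable ?ue//; apply: leq_trans (eN _ ue) (ltnW Nn).
have flowW (x : X) r : closed_simplex c x -> bsupp (flow x r) `<=` [set` W].
  move=> cx; have [m [tau [_ fs _]]] := flow_bary_repr x r.
  by move=> z /fs[u xu [[_ ->]|[_ ->]]] /=; apply: chiW; exact: supp_e xu.
have nearc : \forall z \near simplex_nbhs c t s, closed_simplex c z.1.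
  by exists 1 => [|z []//]; rewrite /= ltr01.
apply: (@cvg_realization _ _ _ _ _ _ W) => [|//|z _].
- by apply: filterS nearc => z; exact: flowW.
- exact: flowW.
pose form (x : X * R) := \sum_(u <- e) (x.1 u * (chi 0 u == z)%:R +
    \sum_(n < N) Num.min (x.1 u) (Num.max 0 (stage n x.2 -
      \sum_(w <- e) (beyond n u w)%:R * x.1 w)) *
      ((chi n.+1 u == z)%:R - (chi n u == z)%:R)).
have formE (x : X * R) : closed_simplex c x.1 -> flow x.1 x.2 z = form x.
  move=> cx; rewrite /= (flow_baryE e_uniq _ (supp_e _ cx) _ _ eN); last exact: bary_ge0.
  by apply: eq_bigr => u _; congr (_ + _); apply: eq_bigr => n _;
     rewrite (massE e_uniq (supp_e _ cx)).
rewrite formE//.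
apply: (@cvg_trans _ (form x @[x --> simplex_nbhs c t s])).
  by apply: near_eq_cvg; apply: filterS nearc => x cx; rewrite formE.
apply: cvg_big => [|u _]; first exact: add_continuous.
apply: cvgD; first by apply: cvgM; [exact: cvg_simplex_bary|exact: cvg_cst].
apply: cvg_big => [|n _]; first exact: add_continuous.
apply: cvgM; last exact: cvg_cst.
apply: cvg_minr; first exact: cvg_simplex_bary.
apply: cvg_maxr; first exact: cvg_cst.
apply: cvgB; first apply: (@cvg_comp _ _ _ (fun z : X * R => z.2) (stage n) _ (nbhs s)).
- exact: cvg_simplex_time.
- exact: cvg_stage.
apply: cvg_big => [|w _]; first exact: add_continuous.
by apply: cvgM; [exact: cvg_cst|exact: cvg_simplex_bary].
Qed.

End MonotoneSequence.

(** * Contraction of a connected component *)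

Section Contraction.
Local Open Scope ring_scope.
Variables (R : realType) (V : choiceType) (le : V -> V -> Prop) (A Q : set V).
Local Notation K := (order_complex le A).
Local Notation X := (realization R K).
Variables (a : V) (Ka : K [set a]).
Hypothesis Qa : Q a.
Hypothesis Q_closed : forall u v, A u -> A v -> le u v \/ le v u -> Q u -> Q v.

Lemma bsupp_closed (t : X) u : t u != 0 -> Q u -> bsupp t `<=` Q.
Proof.
have [_ _ tA tot] := bary_supp t => tu Qu v tv.
by apply: Q_closed Qu; [exact: tA|exact: tA|exact: tot].
Qed.

(** A simplex is a chain, so [B] contains it or misses it; any radius works. *)
Lemma weak_open_bsupp (B : set V) :
  (forall u v, A u -> A v -> le u v \/ le v u -> B u -> B v) ->
  open [set t : X | bsupp t `<=` B].
Proof.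
move=> BC; rewrite realization_openE => c [_ _ cA tot] t ct tB.
exists 1 => // s cs _ v sv; have [_ [u tu] _ _] := bary_supp t.
by apply: (BC u); [exact/cA/ct|exact/cA/cs|apply: tot; [exact: ct|exact: cs]|exact: tB].
Qed.

(** The points supported in [Q] form an open set, and so does their complement, which consists of
    the points supported outside [Q]. *)
Lemma component_bsupp (t : X) :
  connected_component setT (vertex R Ka) t -> bsupp t `<=` Q.
Proof.
move=> [C [Ca _ cC] Ct]; pose U := [set t : X | bsupp t `<=` Q].
suff CU : C `&` U = C by move: Ct; rewrite -{1}CU => -[].
have oU : open U by exact: weak_open_bsupp.
apply: cC; [|by exists U|exists U => //].
  exists (vertex R Ka); split=> // u; rewrite /bsupp /= /dirac_bary.
  by case: (eqVneq u a) => [->//|_]; rewrite eqxx.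
rewrite -openC (_ : ~` U = [set t : X | bsupp t `<=` ~` Q]).
  apply: weak_open_bsupp => u v Au Av uv nQu Qv; apply: nQu.
  by apply: Q_closed Qv => //; case: uv; [right|left].
apply/seteqP; split=> x /=.
  by move=> nU u xu Qu; apply: nU; exact: bsupp_closed xu Qu.
by move=> xQ Ux; have [_ [u xu] _ _] := bary_supp x; exact: xQ xu (Ux _ xu).
Qed.

Hypothesis leV_trans : forall v u w, le u v -> le v w -> le u w.
Hypothesis leV_anti : forall u v, le u v -> le v u -> u = v.
Variables (chi : nat -> V -> V) (up : nat -> bool).
Hypothesis chiA : forall n u, A u -> A (chi n u).
Hypothesis chi_mono : forall n u v, A u -> A v -> le u v -> le (chi n u) (chi n v).
Hypothesis chi_step : forall n u, A u ->
  if up n then le (chi n u) (chi n.+1 u) else le (chi n.+1 u) (chi n u).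
Hypothesis chi_stable : forall u, exists N, forall n, (N <= n)%N -> chi n u = u.
Hypothesis chi_start : forall u, Q u -> chi 0 u = a.

Theorem component_contractible :
  contractible R (connected_component setT (vertex R Ka)).
Proof.
have thr u : {N | forall n, (N <= n)%N -> chi n u = u} by exact: cid (chi_stable u).
pose T u := sval (thr u).
have TP u n : (T u <= n)%N -> chi n u = u by rewrite /T; case: (thr u) => N /= h; exact: h.
pose h t s := flow (R := R) leV_trans leV_anti chiA chi_mono chi_step TP t s.
have h1 t : bsupp t `<=` Q -> h t 1 = vertex R Ka.
  move=> tQ; apply: realization_inj => z; rewrite /h /= flow_bary_at1//.
  rewrite (eq_fsbigr (fun u => t u * (a == z)%:R)); last first.
    move=> u _; have [->|tu] := eqVneq (t u) 0; first by rewrite !mul0r.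
    by rewrite chi_start//; exact: tQ.
  rewrite /dirac_bary eq_sym; case: (z == a).
    by under eq_fsbigr do rewrite mulr1; exact: bary_sum.
  by rewrite fsbig1// => u _; rewrite mulr0.
have hc : continuous (fun z : X * R => h z.1 z.2) by exact: flow_continuous.
(* The trajectory is connected and ends at the vertex [a], so it stays in the component. *)
have path t : bsupp t `<=` Q ->
    h t @` `[0, 1] `<=` connected_component setT (vertex R Ka).
  move=> tQ; apply: connected_component_max => //.
    by exists 1; [rewrite /= in_itv /= ler01 lexx|exact: h1].
  apply: connected_continuous_connected; first exact: segment_connected.
  apply: continuous_subspaceT => s.
  apply: (@continuous_comp _ _ _ (fun s => (t, s)) (fun z : X * R => h z.1 z.2)).
    by apply: (cvg_pair (F := nbhs s) (f := fun=> t) (g := id) (G := nbhs t) (H := nbhs s));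
      [exact: cvg_cst|exact: cvg_id].
  exact: hc.
exists (vertex R Ka); first exact: connected_component_refl.
exists (fun z => h z.1 z.2); split.
- exact: continuous_subspaceT.
- move=> _ [[t s] [/= Ct s01] <-]; apply: (path t); last by exists s.
  exact: component_bsupp.
- by move=> t _; exact: flow_at0.
- by move=> t Ct; apply: h1; exact: component_bsupp.
Qed.

End Contraction.

(** * Geodesics in trees *)

(** [rev (belast x s)] encodes the reversed walk, whose origin is [last x s]. *)
Lemma path_rev_walk (G : graph) (x : G) s : path adj x s ->
  path adj (last x s) (rev (belast x s)).
Proof. by rewrite rev_path; under eq_path do rewrite adj_sym. Qed.

Lemma last_rev_walk (T : Type) (x : T) s : last (last x s) (rev (belast x s)) = x.
Proof. by case: s => [|a s] //=; rewrite rev_cons last_rcons. Qed.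

Lemma rev_walkK (T : Type) (x : T) s :
  rev (belast (last x s) (rev (belast x s))) = s.
Proof.
case/lastP: s => [//|s a].
by rewrite last_rcons belast_rcons rev_cons belast_rcons rev_cons revK.
Qed.

Lemma map_rev_walk (T1 T2 : Type) (h : T1 -> T2) (x : T1) s :
  map h (rev (belast x s)) = rev (belast (h x) (map h s)).
Proof. by rewrite map_rev; congr rev; elim: s x => //= y s IH x; rewrite IH. Qed.

Lemma adj_take (G : graph) (u : G) s i : path adj u s -> i < size s ->
  adj (last u (take i s)) (last u (take i.+1 s)).
Proof.
move=> us si; have := take_path i.+1 us.
by rewrite (take_nth u si) rcons_path last_rcons => /andP[].
Qed.

Section Tree.
Variable T : graph.
Hypothesis T_tree : is_tree T.

Definition geodesic (u : T) (p : seq T) := path adj u p && uniq (u :: p).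

Lemma tree_loopless (u : T) : adj u u = false.
Proof.
apply/negP => uu; have [_ /(_ [:: u])] := T_tree.
by rewrite /ucycle /= uu => /(_ isT)[].
Qed.

(** If the first edges differ, the rest of [p] followed by the reverse of the rest of [q] avoids
    [u]; shortened and closed up through [u], it is a cycle of length at least 3. *)
Lemma geodesic_inj (u : T) p q : geodesic u p -> geodesic u q ->
  last u p = last u q -> p = q.
Proof.
have [_ acyc] := T_tree.
elim: p u q => [|x p IH] u [|y q] //=.
- move=> _ /andP[_ /= /andP[uq _]] ul.
  by move: uq; rewrite {1}ul mem_last.
- move=> /andP[_ /= /andP[uq _]] _ ul.
  by move: uq; rewrite -{1}ul mem_last.
move=> gp gq pq; have [xy|xy] := eqVneq x y.
  subst y; congr cons; apply: IH pq.
    by move: gp; rewrite /geodesic /= => /andP[/andP[_ ->] /andP[_ ->]].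
  by move: gq; rewrite /geodesic /= => /andP[/andP[_ ->] /andP[_ ->]].
case/andP: gp => /= /andP[ux xp] /andP[uxp _].
case/andP: gq => /= /andP[uy yq] /andP[uyq _].
pose s := p ++ rev (belast y q).
have xs : path adj x s by rewrite cat_path xp pq path_rev_walk.
have ls : last x s = y by rewrite last_cat pq last_rev_walk.
have us : u \notin x :: s.
  move: uxp uyq; rewrite /s !inE mem_cat mem_rev !negb_or => /andP[-> ->] /andP[uy' uq] /=.
  by apply: contraNN uq => /mem_belast; rewrite inE (negPf uy').
move: ls; case: (shortenP xs) => s' xs' uniq_s' ss' ls'.
have /acyc : ucycle adj [:: u, x & s'].
  rewrite /ucycle /= ux rcons_path xs' ls' adj_sym uy /=.
  rewrite -[_ && uniq _]/(uniq (x :: s')) uniq_s' andbT; apply: contra us.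
  by rewrite !inE => /orP[->//|/ss' ->]; rewrite orbT.
case: s' {xs' uniq_s' ss'} ls' => [/=|? ? _ []//].
by move=> yx; rewrite yx eqxx in xy.
Qed.

Lemma geodesic_ex (u a : T) : exists p, geodesic u p && (last u p == a).
Proof.
have [conn _] := T_tree; have [s us sa] := conn u a.
move: sa; case: (shortenP us) => p up unp _ pa.
by exists p; rewrite /geodesic up unp pa eqxx.
Qed.

Definition geo (u a : T) : seq T := xchoose (geodesic_ex u a).

Lemma geo_geodesic u a : geodesic u (geo u a).
Proof. by case/andP: (xchooseP (geodesic_ex u a)). Qed.

Lemma geo_path u a : path adj u (geo u a).
Proof. by case/andP: (geo_geodesic u a). Qed.

Lemma geo_uniq u a : uniq (u :: geo u a).
Proof. by case/andP: (geo_geodesic u a). Qed.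

Lemma last_geo u a : last u (geo u a) = a.
Proof. by case/andP: (xchooseP (geodesic_ex u a)) => _ /eqP. Qed.

Lemma geo_eq u p : geodesic u p -> geo u (last u p) = p.
Proof.
by move=> up; apply: geodesic_inj (geo_geodesic _ _) up _; rewrite last_geo.
Qed.

Lemma geo_refl u : geo u u = [::].
Proof. exact: (@geo_eq u [::]). Qed.

Lemma geo_edge u a : adj u a -> geo u a = [:: a].
Proof.
move=> ua; apply: (@geo_eq u [:: a]); rewrite /geodesic /= ua inE andbT /=.
rewrite andbT; by apply: contraTneq ua => ->; rewrite tree_loopless.
Qed.

Lemma geodesic_cat u p q : geodesic u (p ++ q) -> geodesic u p /\ geodesic (last u p) q.
Proof.
move=> /andP[]; rewrite cat_path -cat_cons cat_uniq => /andP[up pq] /and3P[un hn uq].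
split; first by rewrite /geodesic up.
rewrite /geodesic pq /= uq andbT; apply: contra hn => lq; apply/hasP.
by exists (last u p); rewrite ?mem_last.
Qed.

Lemma geo_take u a n : geo u (last u (take n (geo u a))) = take n (geo u a).
Proof.
apply: geo_eq; have := geo_geodesic u a.
by rewrite -{1}(cat_take_drop n (geo u a)) => /geodesic_cat[].
Qed.

(** If [u'] is off the geodesic, it can be put in front; if it is on it, it must be the first step,
    as an edge is the geodesic between its ends. *)
Lemma geo_head u u' a : adj u' u ->
  geo u' a = u :: geo u a \/ geo u a = u' :: geo u' a.
Proof.
move=> u'u; have [u'p|u'p] := boolP (u' \in u :: geo u a); last first.
  left; rewrite -{1}(last_geo u a) -[last u _]/(last u' (u :: geo u a)).
  apply: geo_eq; rewrite /geodesic /= u'u geo_path /=; rewrite u'p.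
  exact: geo_uniq.
right; move: u'p; rewrite inE => /orP[/eqP e|u'p].
  by move: u'u; rewrite e tree_loopless.
have := last_geo u a; have := geo_geodesic u a.
case/splitPr: u'p => p1 p2; rewrite -cat_rcons => /geodesic_cat[g1 g2].
rewrite last_cat last_rcons in g2 * => l2.
have e1 : rcons p1 u' = [:: u'].
  have := geo_eq g1; rewrite last_rcons => <-.
  by apply: geo_edge; rewrite adj_sym.
by rewrite e1 -l2 (geo_eq g2).
Qed.

Lemma geo_last u a b : adj a b ->
  geo u b = rcons (geo u a) b \/ geo u a = rcons (geo u b) a.
Proof.
move=> ab; have [bp|bp] := boolP (b \in u :: geo u a); last first.
  left; rewrite -{1}(last_rcons u (geo u a) b); apply: geo_eq.
  rewrite /geodesic rcons_path geo_path last_geo ab /=.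
  rewrite mem_rcons inE rcons_uniq negb_or.
  move: bp (geo_uniq u a); rewrite inE negb_or /= => /andP[bu ->] /andP[-> ->].
  by rewrite eq_sym bu.
right; have := last_geo u a; have := geo_geodesic u a.
case/splitPl: bp => p1 p2 l1 /geodesic_cat[g1 g2]; rewrite last_cat l1 => l2.
rewrite l1 in g2; rewrite -l1 (geo_eq g1).
have := geo_eq g2; rewrite l2 => <-.
by rewrite geo_edge ?cats1// adj_sym.
Qed.

(** The walks from [a] to [b] through [c] and through [d] are both geodesics. *)
Lemma tree_common_nbr (a b c d : T) : adj a c -> adj b c -> adj a d -> adj b d ->
  a <> b -> c = d.
Proof.
move=> ac bc ad bd ab.
have g x : adj a x -> adj b x -> geo a b = [:: x; b].
  move=> ax bx; apply: (@geo_eq a [:: x; b]).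
  rewrite /geodesic /= ax adj_sym bx /= !inE andbT negb_or.
  have -> : a != x by apply: contraTneq ax => ->; rewrite tree_loopless.
  have -> : x != b by apply: contraTneq bx => ->; rewrite tree_loopless.
  by rewrite andbT; apply/eqP.
by have := g _ ac bc; rewrite (g _ ad bd) => -[->].
Qed.

(** Across an edge the distance to [u] changes by exactly one. *)
Lemma geo_parity (u a b c : T) : adj a c -> adj b c ->
  odd (size (geo u a)) = odd (size (geo u b)).
Proof.
suff h x y : adj x y -> odd (size (geo u x)) = ~~ odd (size (geo u y)).
  by move=> /h -> /h ->.
by move=> xy; case: (geo_last u xy) => ->; rewrite size_rcons //= negbK.
Qed.

Lemma geo_size_adj (u a b : T) : adj a b -> size (geo u a) <= (size (geo u b)).+1.
Proof.
by move=> xy; case: (geo_last u xy) => ->; rewrite size_rcons//; exact: leqW.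
Qed.

Lemma geo_morph (phi : T -> T) u a : {homo phi : x y / adj x y} -> injective phi ->
  geo (phi u) (phi a) = map phi (geo u a).
Proof.
move=> phi_adj phi_inj.
rewrite -{1}(last_geo u a) -last_map; apply: geo_eq.
have /andP[ua uq] := geo_geodesic u a.
rewrite /geodesic path_map -map_cons map_inj_uniq// uq andbT.
exact: sub_path ua.
Qed.

End Tree.

(** * Retracting equivariant multihomomorphisms into a tree *)

Section EquivariantRetraction.
Variables (X T : graph) (T_tree : is_tree T) (f : graph_hom X T) (Gam : groupType).
Variables (aX : Gam -> X -> X) (aT : Gam -> T -> T).
Hypothesis aX_adj : forall g, {homo aX g : x y / adj x y}.
Hypothesis aT_adj : forall g, {homo aT g : x y / adj x y}.
Hypothesis aX1 : forall x, aX 1%g x = x.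
Hypothesis aT1 : forall a, aT 1%g a = a.
Hypothesis aXM : forall g h x, aX g (aX h x) = aX (g * h)%g x.
Hypothesis aTM : forall g h a, aT g (aT h a) = aT (g * h)%g a.
Hypothesis f_equiv : forall g x, f (aX g x) = aT g (f x).
(** [orb] labels the finitely many orbits. Two edges with equal labels at both ends are related by a
    single group element, as is the case when the label is a covering projection. *)
Variables (I : eqType) (orb : X -> I) (orbs : seq I).
Hypothesis orb_mem : forall x, orb x \in orbs.
Hypothesis orb_edge : forall x x' y y', adj x x' -> adj y y' -> orb x = orb y ->
  orb x' = orb y' -> exists2 g, y = aX g x & y' = aX g x'.
Hypothesis orb_vertex : forall x y, orb x = orb y -> exists g, y = aX g x.
Hypothesis X_edge : forall x : X, exists y, adj x y.

Local Notation dist := (fun u a => size (geo T_tree u a)).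

Lemma aXK g : cancel (aX g) (aX g^-1%g).
Proof. by move=> x; rewrite aXM mulVg aX1. Qed.

Lemma aTK g : cancel (aT g) (aT g^-1%g).
Proof. by move=> x; rewrite aTM mulVg aT1. Qed.

Lemma geo_equiv g u a : geo T_tree (aT g u) (aT g a) = map (aT g) (geo T_tree u a).
Proof. by apply: geo_morph; [exact: aT_adj|exact: can_inj (aTK g)]. Qed.

(* Every vertex of [S] has two neighbours in [S] with distinct images, so it lies
   on a bi-infinite walk of [S] mapped by [f] to a geodesic line of the tree; no
   multihomomorphism in the component of [f] can differ from [f] there. *)
Definition rigid (x : X) : Prop := exists S : set X, S x /\
  forall y, S y -> exists z1 z2, [/\ S z1, S z2, adj y z1, adj y z2 & f z1 <> f z2].

(** Chains of [r] obstructions, as walks from [x] whose image sets out towards [c]; [c' <> f x]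
    forbids backtracking, so the image is a geodesic. *)
Fixpoint ahead (r : nat) (x : X) (c : T) : Prop :=
  if r is r'.+1 then
    exists y c', [/\ adj x y, ~ rigid y, f y = c, c' <> f x & ahead r' y c']
  else True.

Lemma ahead_walk r x c : ahead r x c -> exists s, [/\ size s = r, path adj x s,
  forall y, y \in s -> ~ rigid y, forall y s', s = y :: s' -> f y = c &
  forall i, i.+1 < size s -> f (nth x (x :: s) i) <> f (nth x (x :: s) i.+2)].
Proof.
elim: r x c => [|r IH] x c /=; first by exists [::].
move=> [y [c' [xy ny fy c'x /IH[s [ss ys ns sc bs]]]]].
exists (y :: s); split => //=; rewrite ?ss ?xy//.
- by move=> z; rewrite inE => /orP[/eqP ->|/ns].
- by move=> ? ? [<-].
move=> [|i] /= si; last first.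
  have d n : n < (size s).+1 -> nth x (y :: s) n = nth y (y :: s) n.
    by move=> ?; apply: set_nth_default.
  have /bs : i.+1 < size s by rewrite ss.
  by rewrite -!d ?ss//; exact: ltn_trans si.
case: s ss sc {ys ns bs} si => [/= <-//|z s _ /(_ z s erefl) /= zc _ e].
by apply: c'x; rewrite e zc.
Qed.

Definition rank_bound := (size orbs * size orbs).+1.
Local Notation M := rank_bound.

(** Pigeonhole on the label pairs of the edges: some [g] carries an earlier edge of a long walk to a
    later one, and the translates of the part in between form a periodic set, which makes [w j]
    rigid. *)
Lemma ahead_bound r x c : ahead r x c -> r < M.
Proof.
move=> /ahead_walk[s [ss xs ns _ bs]]; rewrite ltnNge; apply/negP => Mr.
pose w := nth x (x :: s).
have ww i : i < r -> adj (w i) (w i.+1) by move=> ir; apply/(pathP x xs); rewrite ss.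
pose E := [seq (orb (w i), orb (w i.+1)) | i <- iota 0 r].
have sE : size E = r by rewrite size_map size_iota.
have EF : {subset E <= [seq (a, b) | a <- orbs, b <- orbs]}.
  by move=> _ /mapP[i _ ->]; apply: allpairs_f; exact: orb_mem.
have : ~~ uniq E.
  by apply/negP => /uniq_leq_size /(_ EF); rewrite size_allpairs sE leqNgt Mr.
move=> /(uniqPn (orb x, orb x))[i [j [ij]]]; rewrite sE => jr.
have ir : i < r by exact: ltn_trans jr.
rewrite !(nth_map 0) ?size_iota// !nth_iota// !add0n => -[e1 e2].
have [g gi gi'] := orb_edge (ww i ir) (ww j jr) e1 e2.
apply: (ns (w j)).
  by rewrite /w; case: (j) ij jr => // j' _ jr /=; rewrite mem_nth ?ss// ltnW.
(* At the ends of the segment the missing neighbours come from [w j = aX g (w i)] and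
   [w j.+1 = aX g (w i.+1)]. *)
exists [set y | exists h k, i < k <= j /\ y = aX h (w k)]; split.
  by exists 1%g, j; rewrite aX1 ij leqnn.
move=> _ [h [k [/andP[ik kj] ->]]].
have k0 : k = k.-1.+1 by rewrite prednK// (leq_ltn_trans _ ik).
exists (aX h (w k.-1)), (aX h (w k.+1)); split.
- have [->|ki] := eqVneq k.-1 i; last by exists h, k.-1; split=> //; lia.
  by exists (h * g^-1)%g, j; split; [lia|rewrite gi -aXM aXK].
- have [e|kj'] := eqVneq k j; last by exists h, k.+1; split=> //; lia.
  exists (h * g)%g, i.+1; split; first by lia.
  by rewrite e gi' aXM.
- by apply: aX_adj; rewrite adj_sym {2}k0; apply: ww; lia.
- by apply: aX_adj; apply: ww; lia.
- rewrite !f_equiv => /(can_inj (aTK h)); rewrite {2}k0; apply: bs.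
  by rewrite ss; lia.
Qed.

Definition rank x c := \max_(r < M | `[< ahead r x c >]) (r : nat).

Lemma rank_lt x c : rank x c < M.
Proof. by rewrite ltnS; apply/bigmax_leqP => r _; rewrite -ltnS. Qed.

Lemma ahead_rank x c : ahead (rank x c) x c.
Proof.
have [|r] := @eq_bigmax_cond 'I_M (fun r => `[< ahead r x c >]) (@nat_of_ord M).
  by apply/card_gt0P; exists ord0; exact/asboolP.
by rewrite /rank => /asboolP h ->.
Qed.

Lemma rank_ge r x c : ahead r x c -> r <= rank x c.
Proof.
move=> h; apply: (@leq_bigmax_cond _ _ (@nat_of_ord M) (Ordinal (ahead_bound h))).
exact/asboolP.
Qed.

(** A longest chain at [y] is prolonged by the step from [x] to [y]. A smaller rank means a later
    step outwards, hence an earlier one when values are pulled back. *)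
Lemma rank_step x y c : adj x y -> ~ rigid y -> c <> f x -> rank y c < rank x (f y).
Proof.
by move=> xy ny cx; apply: rank_ge; exists y, c; split=> //; exact: ahead_rank.
Qed.

Lemma rigid_equiv g x : rigid x -> rigid (aX g x).
Proof.
move=> [S [Sx SP]]; exists (aX g @` S); split; first by exists x.
move=> _ [y /SP[z1 [z2 [S1 S2 a1 a2 f12]]] <-].
exists (aX g z1), (aX g z2); split; [by exists z1|by exists z2|exact: aX_adj|exact: aX_adj|].
by rewrite !f_equiv => /(can_inj (aTK g)).
Qed.

Lemma ahead_equiv g r x c : ahead r x c -> ahead r (aX g x) (aT g c).
Proof.
elim: r x c => //= r IH x c [y [c' [xy ny fy c'x /IH h]]].
exists (aX g y), (aT g c'); split=> //; first exact: aX_adj.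
- by move=> /(rigid_equiv g^-1%g); rewrite aXK.
- by rewrite f_equiv fy.
- by rewrite f_equiv => /(can_inj (aTK g)).
Qed.

Lemma rank_equiv g x c : rank (aX g x) (aT g c) = rank x c.
Proof.
apply/eqP; rewrite eqn_leq; apply/andP; split; apply: rank_ge.
  by have := ahead_equiv g^-1%g (ahead_rank (aX g x) (aT g c)); rewrite aXK aTK.
exact/ahead_equiv/ahead_rank.
Qed.

(* The point [a] starts at [f x] at time 0 and travels to [a] along the geodesic,
   two steps at a time, its [n]-th double step taking place at time
   [n * M - rank]. *)
Definition slide (i : nat) (x : X) (a : T) : T :=
  let p := geo T_tree (f x) a in
  last (f x) (take (2 * ((i + rank x (head (f x) p)) %/ M)) p).

(** Both values travel on one path from [f x] through [f y], at positions [2 * al] and [2 * be + 1]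
    cut off at their targets; adjacency reduces to [be <= al <= be + 1]. *)
Lemma slide_forward i j x y a b : i <= j.+1 -> j <= i.+1 ->
  adj x y -> adj a b -> (rigid y -> b = f y) ->
  ~~ odd (dist (f x) a) ->
  geo T_tree (f x) a = f y :: geo T_tree (f y) a ->
  adj (slide i x a) (slide j y b).
Proof.
move=> ij ji xy ab yb ev px; rewrite px /= in ev.
set p' := geo T_tree (f y) a in px ev *; pose q := geo T_tree (f y) b.
pose al := (i + rank x (f y)) %/ M; pose be := (j + rank y (head (f y) q)) %/ M.
have -> : slide i x a = last (f x) (take (2 * al) (f y :: p')) by rewrite /slide px.
have -> : slide j y b = last (f x) (take (2 * be).+1 (f y :: q)) by [].
have ux : uniq (f x :: f y :: p') by rewrite -px; exact: geo_uniq.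
have px_path : path adj (f x) (f y :: p') by rewrite -px; exact: geo_path.
have px_last : last (f x) (f y :: p') = a by rewrite -px; exact: last_geo.
(* The strict drop of the rank absorbs the offset of one between [i] and [j] in the first bound;
   [rank < M] gives the second. The premises make [y] non-rigid and [c] different from [f x]. *)
have be_al : q != [::] -> f x \notin q -> be <= al <= be.+1.
  case Dq : q => [//|c q'] _; rewrite inE negb_or => /andP[/eqP cx _].
  have ny : ~ rigid y.
    by move=> /yb e; move: Dq; rewrite /q e geo_refl.
  have rk : rank y c < rank x (f y) by apply: rank_step => // e; apply: cx.
  have rM := rank_lt x (f y).
  rewrite /al /be Dq /=; apply/andP; split; first by apply: leq_div2r; lia.
  rewrite -addn1 -[1]/(nat_of_bool (0 < M)) -divnn -divnDr//; apply: leq_div2r; lia.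
(* Truncations of one path to lengths differing by one have adjacent ends; [minn] accounts for a
   [take] beyond the end. *)
have key L A B : path adj (f x) L -> A <= size L ->
    A = (minn B (size L)).+1 \/ minn B (size L) = A.+1 ->
    adj (last (f x) (take A L)) (last (f x) (take B L)).
  have -> : take B L = take (minn B (size L)) L.
    by rewrite /minn; case: ltnP => // /take_oversize ->; rewrite take_size.
  have BL := geq_minr B (size L); move: (minn _ _) BL => {}B BL Lp AL [e|e].
    by rewrite adj_sym e; apply: adj_take; rewrite // -e.
  by rewrite e; apply: adj_take; rewrite // -e.
move: (geo_last T_tree (f y) ab); rewrite -/q -/p' => -[Dq|Dp'].
  have xb : geo T_tree (f x) b = f y :: q.
    case: (geo_head T_tree b (hom_adj f xy)) => //; rewrite -/q Dq.
    case: (p') ev ux => [|z s] //= _ + [zx _].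
    by rewrite zx !inE eqxx orbT.
  have qx : f x \notin q.
    by have := geo_uniq T_tree (f x) b; rewrite xb /= inE negb_or => /andP[/andP[]].
  have /andP[a1 a2] : be <= al <= be.+1 by apply: be_al => //; rewrite Dq; case: (p').
  have -> : take (2 * al) (f y :: p') = take (minn (2 * al) (size p').+1) (f y :: q).
    by rewrite take_min Dq -cats1 -cat_cons take_size_cat.
  apply: key; first by rewrite -xb geo_path.
    by rewrite /= Dq size_rcons; lia.
  by rewrite /= Dq size_rcons; lia.
have sp : size p' = (size q).+1 by rewrite Dp' size_rcons.
have -> : take (2 * be).+1 (f y :: q) = take (minn (2 * be).+1 (size q).+1) (f y :: p').
  by rewrite take_min Dp' -cats1 -cat_cons take_size_cat.
have qx : f x \notin q.
  by move: ux; rewrite Dp' /= inE mem_rcons inE !negb_or => /andP[/and3P[]].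
rewrite adj_sym; apply: key => //; rewrite /= ?sp; first lia.
(* If [q] is empty, [b = f y] stays put and the value at [x] jumps between [f x] and [a], both
   adjacent to [f y]. *)
have [q0|/eqP q0] := eqVneq q [::]; first by rewrite q0 /=; lia.
have /andP[a1 a2] := be_al (introN eqP q0) qx.
by move: ev; rewrite sp /=; lia.
Qed.

Lemma slide_adj i j x y a b : i <= j.+1 -> j <= i.+1 -> adj x y -> adj a b ->
  (rigid x -> a = f x) -> (rigid y -> b = f y) ->
  ~~ odd (dist (f x) a) -> ~~ odd (dist (f y) b) ->
  adj (slide i x a) (slide j y b).
Proof.
move=> ij ji xy ab xa yb ex ey.
case: (geo_head T_tree a (hom_adj f xy)) => [xh|yh]; first exact: slide_forward.
have ba : adj b a by rewrite adj_sym.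
have yx : adj y x by rewrite adj_sym.
case: (geo_head T_tree b (hom_adj f yx)) => [yh'|xh].
  by rewrite adj_sym; apply: slide_forward.
(* Here [a] lies on the side of [f x] and [b] on that of [f y]; being adjacent, they are [f x] and
   [f y] themselves. *)
have e0 : geo T_tree (f y) b = [::].
  have := geo_last T_tree (f y) ab; have := geo_uniq T_tree (f x) b; rewrite yh xh.
  case: (geo T_tree (f y) b) => // c q /= /and3P[nx _ _] e.
  by case: e nx => [[<- _]|[-> _]]; rewrite !inE eqxx orbT.
have bfy : b = f y by rewrite -(last_geo T_tree (f y) b) e0.
have := geo_last T_tree (f x) ba; rewrite xh e0 /= => -[e1|].
  have := geo_uniq T_tree (f y) a; rewrite yh e1 /= bfy.
  by rewrite !inE eqxx orbT.
case e1 : (geo T_tree (f x) a) => [|? [|??]] //= _.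
by rewrite /slide e0 e1 /= hom_adj.
Qed.

Lemma slide_equiv i g x a : slide i (aX g x) (aT g a) = aT g (slide i x a).
Proof.
rewrite /slide f_equiv geo_equiv /= -map_take last_map.
by case: (geo _ _ _) => [//|c p] /=; rewrite rank_equiv.
Qed.

Lemma slide_at0 x a : slide 0 x a = f x.
Proof. by rewrite /slide add0n divn_small ?rank_lt// muln0 take0. Qed.

Lemma slide_stable i x a : dist (f x) a * M <= i -> slide i x a = a.
Proof.
move=> ai; rewrite /slide take_oversize ?last_geo//.
have : dist (f x) a <= (i + rank x (head (f x) (geo T_tree (f x) a))) %/ M.
  by rewrite leq_divRL// (leq_trans ai)// leq_addr.
by move/leq_trans; apply; rewrite leq_pmull.
Qed.

Lemma slide_even i x a : ~~ odd (dist (f x) a) -> ~~ odd (dist (f x) (slide i x a)).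
Proof.
rewrite /slide geo_take size_take; case: ifP => // _ _.
by rewrite mul2n odd_double.
Qed.

Lemma slide_fix i x : slide i x (f x) = f x.
Proof. by rewrite /slide geo_refl. Qed.

(** * The poset of equivariant multihomomorphisms *)

Definition equivariant : set (X -> set T) := multihom X T `&`
  [set eta | forall g x, eta (aX g x) = aT g @` eta x].

Definition even_fixed : set (X -> set T) := equivariant `&`
  [set eta | (forall x a, eta x a -> ~~ odd (dist (f x) a)) /\
             (forall x, rigid x -> eta x = [set f x])].

Lemma even_fixed_hom : even_fixed (multihom_of f).
Proof.
split; [split; [split|]|split] => [x|x y xy a b -> ->|g x|x a ->|//].
- by exists (f x).
- exact: hom_adj.
- by rewrite /multihom_of image_set1 f_equiv.
- by rewrite geo_refl.
Qed.

(** All values at [x] are adjacent to one value at a neighbour, so a value common to [eta] and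
    [theta] fixes their parity. At a rigid [x], each value of a larger [theta] is, like [f x], a
    common neighbour of the distinct [f y] and [f z]. *)
Lemma even_fixed_closed eta theta : equivariant eta -> equivariant theta ->
  multihom_le X T eta theta \/ multihom_le X T theta eta ->
  even_fixed eta -> even_fixed theta.
Proof.
move=> [[eta0 etaA] _] theq comp [_ [eta_even eta_fix]].
have [[th0 thA] _] := theq; split=> //.
have common x : exists2 a, eta x a & theta x a.
  by case: comp => le; [have [a] := eta0 x|have [a] := th0 x] => xa; exists a => //; exact: le.
split=> [x a xa|x rx].
  have [y xy] := X_edge x; have [b etab thb] := common x.
  have [c yc] := th0 y.
  rewrite (geo_parity T_tree (f x) (thA _ _ xy _ _ xa yc) (thA _ _ xy _ _ thb yc)).
  exact: eta_even.
suff sub : theta x `<=` [set f x].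
  by apply/seteqP; split=> // _ ->; have [a] := th0 x; move=> /[dup] /sub ->.
case: comp => le a xa; last by have := le x a xa; rewrite eta_fix.
have [S [Sx SP]] := rx; have [y [z [Sy Sz xy xz fyz]]] := SP x Sx.
have rig u : S u -> theta u (f u).
  move=> Su; apply: le; rewrite eta_fix//; by exists S.
apply: (@tree_common_nbr _ T_tree (f y) (f z)); rewrite 1?adj_sym ?hom_adj//.
  exact: thA xa (rig _ Sy).
exact: thA xa (rig _ Sz).
Qed.

(** For consecutive times the union dominates both slides, which need not be comparable with each
    other. *)
Definition push i j (eta : X -> set T) : X -> set T :=
  fun x => (slide i x @` eta x) `|` (slide j x @` eta x).

Lemma push_even_fixed i j eta : i <= j.+1 -> j <= i.+1 -> even_fixed eta ->
  even_fixed (push i j eta).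
Proof.
move=> ij ji [[[eta0 etaA] etaE] [even_eta fix_eta]].
have fix1 x a : eta x a -> rigid x -> a = f x by move=> + rx; rewrite fix_eta.
split; [split; [split|]|split].
- by move=> x; have [a xa] := eta0 x; exists (slide i x a); left; exists a.
- move=> x y xy _ _ [] [a xa <-] [] [b yb <-];
    (apply: slide_adj => //; [exact: etaA xa yb|exact: fix1|exact: fix1|
      exact: even_eta|exact: even_eta]).
- move=> g x; rewrite /push etaE image_setU; congr (_ `|` _);
    by rewrite !image_comp; apply: eq_imagel => a _ /=; rewrite slide_equiv.
- by move=> x _ [] [a xa <-]; apply/slide_even/even_eta.
- by move=> x rx; rewrite /push fix_eta// !image_set1 !slide_fix setUid.
Qed.

(** The values at [x] are adjacent to one value at a neighbour, and equivariance makes the bound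
    constant along each of the finitely many orbits. *)
Lemma even_fixed_bounded eta : even_fixed eta ->
  exists D, forall x a, eta x a -> dist (f x) a <= D.
Proof.
move=> [[[eta0 etaA] etaE] _].
have bound1 x : exists D, forall a, eta x a -> dist (f x) a <= D.
  have [y xy] := X_edge x; have [c yc] := eta0 y.
  by exists (dist (f x) c).+1 => a xa; apply: geo_size_adj; exact: etaA xa yc.
suff [D DP] : exists D, forall x, orb x \in orbs -> forall a, eta x a -> dist (f x) a <= D.
  by exists D => x; exact: DP.
elim: (orbs) => [|o l [D DP]]; first by exists 0.
have [[x0 ox0]|no] := pselect (exists x, orb x = o); last first.
  exists D => x; rewrite inE => /orP[/eqP ox|/DP//].
  by case: no; exists x.
have [D0 D0P] := bound1 x0; exists (maxn D0 D) => x; rewrite inE.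
move=> /orP[/eqP ox|xl] a xa; rewrite leq_max; last by rewrite (DP x)// orbT.
have [g gx] := orb_vertex (etrans ox0 (esym ox)).
move: xa; rewrite gx etaE => -[b /D0P xb <-].
by rewrite f_equiv geo_equiv size_map xb.
Qed.

(** Even [n] gives the slide at time [n/2], odd [n] the union of two consecutive slides. Closure of
    [even_fixed] under comparability makes the identity elsewhere compatible with monotonicity. *)
Definition retract n (eta : X -> set T) : X -> set T :=
  if `[< even_fixed eta >] then push n./2 (uphalf n) eta else eta.

Lemma retractE n eta : even_fixed eta -> retract n eta = push n./2 (uphalf n) eta.
Proof. by rewrite /retract => /asboolP ->. Qed.

Lemma retract_equivariant n eta : equivariant eta -> equivariant (retract n eta).
Proof.
rewrite /retract; case: asboolP => // Qeta _.
by case: (push_even_fixed (i := n./2) (j := uphalf n) _ _ Qeta) => //; rewrite uphalf_half; lia.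
Qed.

Lemma retract_mono n eta theta : equivariant eta -> equivariant theta ->
  multihom_le X T eta theta -> multihom_le X T (retract n eta) (retract n theta).
Proof.
move=> Ae At le x; rewrite /retract.
have [Qe|nQe] := asboolP (even_fixed eta); have [Qt|nQt] := asboolP (even_fixed theta).
- by apply: setUSS; apply: image_subset; exact: le.
- by case: nQt; apply: even_fixed_closed Qe => //; left.
- by case: nQe; apply: even_fixed_closed Qt => //; right.
- exact: le.
Qed.

Lemma retract_step n eta :
  if ~~ odd n then multihom_le X T (retract n eta) (retract n.+1 eta)
  else multihom_le X T (retract n.+1 eta) (retract n eta).
Proof.
have [Qe|nQe] := pselect (even_fixed eta); last first.
  by rewrite /retract; have /asboolPn/negPf -> := nQe; case: odd => x.
rewrite !retractE//; case: ifP => on x;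
  rewrite /push -[uphalf n.+1]/(n./2.+1) -[n.+1./2]/(uphalf n) uphalf_half.
  by rewrite (negPf on) add0n setUid; exact: subsetUl.
by move/negbFE: on => ->; rewrite add1n setUid; exact: subsetUr.
Qed.

Lemma retract_stable eta : exists N, forall n, N <= n -> retract n eta = eta.
Proof.
have [Qe|nQe] := pselect (even_fixed eta); last first.
  by exists 0 => n _; rewrite /retract; have /asboolPn/negPf -> := nQe.
have [D DP] := even_fixed_bounded Qe.
have sl i x : D * M <= i -> slide i x @` eta x = eta x.
  move=> Di; rewrite -[RHS]image_id; apply: eq_imagel => a xa.
  by apply: slide_stable; apply: leq_trans Di; rewrite leq_mul2r DP ?orbT.
exists (2 * (D * M)) => n Dn; rewrite retractE//; apply/funext => x.
by rewrite /push !sl ?setUid//; rewrite ?uphalf_half; lia.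
Qed.

Lemma retract_start eta : even_fixed eta -> retract 0 eta = multihom_of f.
Proof.
move=> Qe; rewrite retractE//; apply/funext => x; rewrite /push /= setUid.
have [[[eta0 _] _] _] := Qe; have [a xa] := eta0 x.
apply/seteqP; split=> [_ [b _ <-]|_ ->]; first by rewrite slide_at0.
by exists a; rewrite ?slide_at0.
Qed.

End EquivariantRetraction.

(** * Lifting walks and the deck action *)

Lemma map_eq_cat (A B : Type) (h : A -> B) s s1 s2 : map h s = s1 ++ s2 ->
  exists a b, [/\ s = a ++ b, map h a = s1 & map h b = s2].
Proof.
move=> e; exists (take (size s1) s), (drop (size s1) s).
by rewrite cat_take_drop map_take map_drop e take_size_cat// drop_size_cat.
Qed.

Section Lifting.
Variables (G' G : graph) (p : graph_hom G' G).
Hypothesis p_cov : two_covering p.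

Lemma cov_inj x y z : adj x y -> adj x z -> p y = p z -> y = z.
Proof.
move=> xy xz; have [[_ inj _] _] := p_cov x; apply: inj; exact/mem_set.
Qed.

Lemma cov_inj2 x y y' z z' : adj x y -> adj y z -> adj x y' -> adj y' z' ->
  p z = p z' -> z = z'.
Proof.
move=> xy yz xy' yz'; have [_ [_ inj _]] := p_cov x.
by apply: inj; apply/mem_set; [exists y|exists y'].
Qed.

Lemma cov_lift x b : adj (p x) b -> exists2 y, adj x y & p y = b.
Proof. by move=> xb; have [[_ _ surj] _] := p_cov x; have [y] := surj _ xb; exists y. Qed.

Lemma lift_ex x s : path adj (p x) s -> exists2 s', path adj x s' & map p s' = s.
Proof.
elim: s x => [|b s IH] x /=; first by exists [::].
move=> /andP[/cov_lift[y xy <-] /IH[s' ys' <-]].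
by exists (y :: s') => //=; rewrite xy.
Qed.

Lemma lift_uniq x s t : path adj x s -> path adj x t -> map p s = map p t -> s = t.
Proof.
elim: s x t => [|y s IH] x [|z t] //= /andP[xy ys] /andP[xz zt] [pyz st].
have yz := cov_inj xy xz pyz; subst z; congr cons; exact: IH ys zt st.
Qed.

Lemma path_map_hom x s : path adj x s -> path adj (p x) (map p s).
Proof. by move=> xs; rewrite path_map; apply: sub_path xs; exact: hom_adj. Qed.

(** Behind an altered vertex the lift rejoins the old one, by injectivity on second neighbourhoods;
    at the last position the equality of ends leaves nothing to alter. *)
Lemma lift_moveB d i x s' t : path adj x s' -> path adj (p x) t ->
  size s' = size t -> last (p x) (map p s') = last (p x) t ->
  (forall j, j != i -> nth d (map p s') j = nth d t j) ->
  exists t', [/\ path adj x t', map p t' = t & last x t' = last x s'].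
Proof.
elim: s' i x t => [|a s' IH] [|i] x [|b t] //=; try by exists [::].
- move=> /andP[xa as'] /andP[xb bt] [sz] l e.
  have st : map p s' = t.
    apply: (@eq_from_nth _ d); first by rewrite size_map.
    by move=> j _; exact: (e j.+1).
  subst t; have [b' xb' pb'] := cov_lift xb; subst b.
  case: s' as' bt l {IH sz e} => [|c s'] /= as' bt l.
    by exists [:: b']; rewrite /= xb' (cov_inj xa xb' l).
  case/andP: as' bt => ac cs' /andP[/cov_lift[c' b'c' pc'] _].
  have cc' := cov_inj2 xb' b'c' xa ac pc'; subst c'.
  by exists [:: b', c & s']; rewrite /= xb' b'c' cs'.
- move=> /andP[xa as'] /andP[xb bt] [sz] l e.
  have pab : p a = b by exact: (e 0).
  subst b; have [|t' [at' pt' lt']] := IH i a t as' bt sz l.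
    by move=> j ji; apply: (e j.+1).
  by exists (a :: t'); rewrite /= xa pt'.
Qed.

Variables (v' : G') (v : G).
Hypothesis pv : p v' = v.

Definition lift_end (s : seq G) : set G' := [set y | exists s',
  [/\ path adj v' s', map p s' = s & last v' s' = y]].

(** Injectivity on neighbourhoods forces a lifted detour to return to where it left. *)
Lemma lift_end_moveA (s t : loop v) : moveA s t ->
  lift_end (val s) = lift_end (val t).
Proof.
move=> [s1 [s2 [y [ay es et]]]]; rewrite es et; apply/seteqP; split=> z.
  move=> [s' [ps' /map_eq_cat[a [b [es' ma mb]]] <-]].
  move: ps'; rewrite es' cat_path last_cat => /andP[pa pb].
  move: ay; rewrite -ma -pv last_map => /cov_lift[y' ay' <-].
  exists (a ++ [:: y', last v' a & b]); split; last by rewrite last_cat.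
    by rewrite cat_path pa /= ay' adj_sym ay'.
  by rewrite map_cat /= mb.
move=> [s' [ps' /map_eq_cat[a [b [es' ma mb]]] <-]].
move: ps'; rewrite es' cat_path last_cat.
case: b mb {es'} => [|y' [|c b]] //= [py' pc mb] /and4P[pa ay' yc cb].
have ec : c = last v' a.
  by apply: cov_inj yc _ _; rewrite 1?adj_sym// pc -ma -pv last_map.
exists (a ++ b); split; [|by rewrite map_cat ma mb|by rewrite last_cat ec].
by rewrite cat_path pa -ec.
Qed.

Lemma lift_end_moveB (s t : loop v) : moveB s t ->
  lift_end (val s) `<=` lift_end (val t).
Proof.
move=> [st [i sti]] z [s' [ps' ms' <-]].
have /andP[pt /eqP lt] := valP t; have /andP[_ /eqP ls] := valP s.
case: (@lift_moveB v i v' s' (val t)) => //.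
- by rewrite pv.
- by rewrite -st -ms' size_map.
- by rewrite pv ms' lt ls.
- by move=> j ji; rewrite ms' sti.
- by move=> t' [pt' mt' <-]; exists t'.
Qed.

Lemma lift_end_homotopic (s t : loop v) : homotopic s t ->
  lift_end (val s) = lift_end (val t).
Proof.
elim=> [{}s {}t [|[es [i ei]]]|//|//|? ? ? _ -> //]; first exact: lift_end_moveA.
apply/seteqP; split; apply: lift_end_moveB; first by split=> //; exists i.
by split=> //; exists i => j ji; rewrite ei.
Qed.

End Lifting.

(** * The deck action of the 2-fundamental group *)

Section DeckAction.
Variables (G' G : graph) (p : graph_hom G' G) (v' : G') (v : G).
Hypothesis p_univ : universal_two_covering p v' v.

Let p_cov : two_covering p. Proof. by case: p_univ. Qed.
Let pv : p v' = v. Proof. by case: p_univ. Qed.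
Let conn : connected_graph G'. Proof. by case: p_univ. Qed.

(** The closed walk along [f1] and back along [f2] is null-homotopic upstairs. Hence [c1] followed
    by its projection is homotopic to [c2], and their lifts end at the same vertex. *)
Lemma deck_endpoint_uniq (g : pi2 v) x y1 y2 :
  deck_endpoint p v' g x y1 -> deck_endpoint p v' g x y2 -> y1 = y2.
Proof.
have [_ _ _ triv] := p_univ.
move=> [c1 [f1 [s1 [ec1 [pf1 lf1] ps1 ms1 ls1]]]].
move=> [c2 [f2 [s2 [ec2 [pf2 lf2] ps2 ms2 ls2]]]].
have [a [b [ss2 ma mb]]] := map_eq_cat ms2.
have pl : closed_walk v' (f1 ++ rev (belast v' f2)).
  rewrite /closed_walk /= cat_path last_cat pf1 lf1 -lf2.
  by rewrite path_rev_walk// last_rev_walk eqxx.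
pose l : loop v' := Sub _ pl.
have l1 : homotopic l (loop_nil v') by apply/class_ofP; rewrite (triv (class_of l)).
move: ps2 ls2; rewrite ss2 cat_path last_cat => /andP[pa pb] lb.
subst v; have : homotopic (loop_cat c1 (loop_map p l)) c2.
  apply: (@rst_trans _ _ _ c1); last by apply/class_ofP; rewrite ec1 ec2.
  apply: (@rst_trans _ _ _ (loop_cat c1 (loop_nil _))).
    apply: homotopic_catr; have := homotopic_map p l1.
    by congr homotopic; exact: val_inj.
  rewrite (_ : loop_cat _ _ = c1); first exact: rst_refl.
  by apply: val_inj; rewrite /= cats0.
move=> /(lift_end_homotopic p_cov erefl) e.
have : lift_end p v' (val c2) (last v' a) by exists a.
rewrite -e /= map_cat catA => -[s [ps /map_eq_cat[d [r [es md mr]]] ls]].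
move: ps ls; rewrite es cat_path last_cat => /andP[pd pr] lr.
have ed : d = s1 by apply: lift_uniq pd ps1 _ => //; rewrite md ms1.
subst d; rewrite ls1 in pr lr.
(* The tail [r] leads from [y1] to the end of the lift of [c2]; its reverse and [b] both lift the
   projection of [f2] from there. *)
have eb : b = rev (belast y1 r).
  apply: lift_uniq pb _ _ => //; first by rewrite -lr path_rev_walk.
  rewrite mb map_rev_walk mr map_rev_walk (_ : p y1 = last (p v') (map p f2)).
    by rewrite rev_walkK.
  have /andP[_ /eqP lc1] := valP c1.
  by rewrite -ls1 -(last_map p) ms1 last_cat lc1 !last_map lf1 lf2.
by rewrite -lb eb -lr last_rev_walk.
Qed.

Lemma deck_endpoint_ex (g : pi2 v) x : deck_endpoint p v' g x !=set0.
Proof.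
have [phi pphi lphi] := conn v' x.
have [c ->] := class_of_surj g; have /andP[pc /eqP lc] := valP c.
have [|s ps ms] := @lift_ex _ _ p p_cov v' (val c ++ map p phi).
  by rewrite cat_path pv pc lc -pv path_map_hom.
by exists (last v' s), c, phi, s.
Qed.

Lemma deck_actP (g : pi2 v) x : deck_endpoint p v' g x (deck_act p v' g x).
Proof. by have [y yP] := deck_endpoint_ex g x; exact: xgetI yP. Qed.

Lemma deck_actE (g : pi2 v) x y : deck_endpoint p v' g x y -> deck_act p v' g x = y.
Proof. exact/deck_endpoint_uniq/deck_actP. Qed.

Lemma deck_act_proj (g : pi2 v) x : p (deck_act p v' g x) = p x.
Proof.
have [c [phi [psi [_ [pphi <-] _ mpsi <-]]]] := deck_actP g x.
have /andP[_ /eqP lc] := valP c.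
by rewrite -!(last_map p) mpsi last_cat pv lc.
Qed.

Lemma deck_act_adj (g : pi2 v) : {homo deck_act p v' g : x y / adj x y}.
Proof.
move=> x y xy; have [c [phi [psi [ec [pphi lphi] ppsi mpsi lpsi]]]] := deck_actP g x.
have [|z xz pz] := @cov_lift _ _ p p_cov (deck_act p v' g x) (p y).
  by rewrite deck_act_proj; exact: hom_adj.
rewrite (@deck_actE g y z)//; exists c, (rcons phi y), (rcons psi z); split=> //.
- by rewrite rcons_path pphi lphi last_rcons.
- by rewrite rcons_path ppsi lpsi.
- by rewrite !map_rcons mpsi pz rcons_cat.
- by rewrite last_rcons.
Qed.

Lemma deck_act1 x : deck_act p v' (1%g : pi2 v) x = x.
Proof.
have [phi pphi lphi] := conn v' x.
by apply: deck_actE; exists (loop_nil v), phi, phi.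
Qed.

Lemma deck_actM (g h : pi2 v) x :
  deck_act p v' g (deck_act p v' h x) = deck_act p v' (g * h)%g x.
Proof.
have [c [phi [psi [ec pphi ppsi mpsi lpsi]]]] := deck_actP h x.
have [d ed] := class_of_surj g; have /andP[pd /eqP ld] := valP d.
have [|s ps ms] := @lift_ex _ _ p p_cov v' (val d ++ map p psi).
  by rewrite cat_path pv pd ld -pv path_map_hom.
rewrite (@deck_actE g _ (last v' s)); last by exists d, psi, s.
apply/esym/deck_actE; exists (loop_cat d c), phi, s; split=> //.
  by rewrite -pi2_mulE ec -ed.
by rewrite ms mpsi /= catA.
Qed.

(** The loop goes along the projection of [psi] and back along that of [phi]. Followed by the
    projection of [phi], it lifts to [psi] with a detour [r] and back, which ends at [y]. *)
Lemma deck_act_fibre x y : p x = p y -> exists g : pi2 v, y = deck_act p v' g x.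
Proof.
move=> pxy; have [phi pphi lphi] := conn v' x; have [psi ppsi lpsi] := conn v' y.
pose back := rev (belast (p v') (map p phi)).
have lphi' : last (p v') (map p phi) = p x by rewrite last_map lphi.
have lpsi' : last (p v') (map p psi) = p y by rewrite last_map lpsi.
have back_path : path adj (p x) back.
  by rewrite -lphi' path_rev_walk// path_map_hom.
have back_last : last (p x) back = v by rewrite -lphi' last_rev_walk.
have cw : closed_walk v (map p psi ++ back).
  rewrite /closed_walk /= cat_path last_cat -pv path_map_hom//= lpsi' -pxy back_path.
  by rewrite back_last pv eqxx.
exists (class_of (Sub _ cw : loop v)); apply/esym/deck_actE.
have [r pr mr] := lift_ex p_cov (eq_ind _ (fun z => path adj z back) back_path _ pxy).
exists (Sub _ cw), phi, (psi ++ r ++ rev (belast y r)); split=> //.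
- by rewrite !cat_path ppsi lpsi pr path_rev_walk.
- rewrite /= !map_cat mr -catA map_rev_walk mr; congr (_ ++ (_ ++ _)).
  by rewrite -pxy -lphi' rev_walkK.
- by rewrite !last_cat lpsi last_rev_walk.
Qed.

Lemma deck_act_edge x x' y y' : adj x x' -> adj y y' -> p x = p y -> p x' = p y' ->
  exists2 g : pi2 v, y = deck_act p v' g x & y' = deck_act p v' g x'.
Proof.
move=> xx' yy' pxy pxy'; have [g gx] := deck_act_fibre pxy; exists g => //.
apply: (cov_inj p_cov yy'); first by rewrite gx; exact: deck_act_adj.
by rewrite deck_act_proj.
Qed.

End DeckAction.

(** [f'] maps a lift of a walk to a lift of its image under [f]. *)
Lemma deck_act_equiv (G H : graph) (f : graph_hom G H) (v : G)
    (G' H' : graph) (pG : graph_hom G' G) (v' : G') (pH : graph_hom H' H) (w' : H')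
    (f' : graph_hom G' H') :
  universal_two_covering pG v' v -> universal_two_covering pH w' (f v) ->
  f' v' = w' -> (forall x, pH (f' x) = f (pG x)) ->
  forall (g : pi2 v) x,
    f' (deck_act pG v' g x) = deck_act pH w' (pi2_map f g) (f' x).
Proof.
move=> uG uH fv pf g x; subst w'.
have [c [phi [psi [<- [pphi lphi] ppsi mpsi lpsi]]]] := deck_actP uG g x.
apply/esym/(deck_actE uH); exists (loop_map f c), (map f' phi), (map f' psi).
have mm s : map pH (map f' s) = map f (map pG s).
  by rewrite -!map_comp; apply: eq_map => z /=; exact: pf.
split; rewrite ?pi2_mapE ?path_map_hom// ?last_map ?lphi ?lpsi//.
by rewrite !mm mpsi map_cat.
Qed.

(** * Contractibility of the component *)

Lemma pi2_map1 (G H : graph) (f : graph_hom G H) (v : G) :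
  pi2_map f (1%g : pi2 v) = 1%g.
Proof. by rewrite pi2_mapE; congr class_of; exact: val_inj. Qed.

Lemma multihom_le_anti (G H : graph) (eta theta : G -> set H) :
  multihom_le G H eta theta -> multihom_le G H theta eta -> eta = theta.
Proof. by move=> et te; apply/funext => x; apply/seteqP; split; [exact: et|exact: te]. Qed.

Lemma multihom_le_trans (G H : graph) (theta eta zeta : G -> set H) :
  multihom_le G H eta theta -> multihom_le G H theta zeta -> multihom_le G H eta zeta.
Proof. by move=> et tz x; apply: subset_trans (tz x); exact: et. Qed.

Theorem theorem4p1 (R : realType) (G H : graph) (f : graph_hom G H) (v : G)
    (G' H' : graph) (pG : graph_hom G' G) (v' : G') (pH : graph_hom H' H) (w' : H')
    (f' : graph_hom G' H') :
  finite_set [set: G] -> finite_set [set: H] ->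
  connected_graph G -> connected_graph H ->
  (exists x y : G, adj x y) ->
  (exists x y : H, adj x y) ->
  universal_two_covering pG v' v ->
  universal_two_covering pH w' (f v) ->
  f' v' = w' -> (forall x, pH (f' x) = f (pG x)) ->
  is_tree H' ->
  exists Kf' : order_complex (multihom_le G' H')
                 (equiv_multihom f v pG v' pH w') [set multihom_of f'],
    contractible R (connected_component setT (vertex R Kf')).
Proof.
move=> finG _ connG _ [a [b ab]] _ uG uH fv pf T_tree.
pose aX (g : pi2 v) := deck_act pG v' g.
pose aT (g : pi2 v) := deck_act pH w' (pi2_map f g).
have aX_adj g : {homo aX g : x y / adj x y} by exact: deck_act_adj.
have aT_adj g : {homo aT g : x y / adj x y} by exact: deck_act_adj.
have aX1 x : aX 1%g x = x by exact: deck_act1.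
have aT1 x : aT 1%g x = x by rewrite /aT pi2_map1; exact: deck_act1.
have aXM g h x : aX g (aX h x) = aX (g * h)%g x by exact: deck_actM.
have aTM g h x : aT g (aT h x) = aT (g * h)%g x.
  by rewrite /aT pi2_mapM; exact: deck_actM.
have f_equiv g x : f' (aX g x) = aT g (f' x) by exact: deck_act_equiv.
(* The orbits are the fibres of [pG], so the vertices of [G] label them. *)
have /finite_seqP[orbs orbsE] := finG.
have orb_mem x : pG x \in orbs by have : [set: G] (pG x) by []; rewrite orbsE.
have p_cov : two_covering pG by case: uG.
have X_edge (x : G') : exists y, adj x y.
  have [c xc] : exists c, adj (pG x) c.
    have [[|c s] /= xs sa] := connG (pG x) a; first by exists b; rewrite sa.
    by exists c; case/andP: xs.
  by have [y xy _] := cov_lift p_cov xc; exists y.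
have orb_edge := @deck_act_edge _ _ _ _ _ uG.
have orb_vertex := @deck_act_fibre _ _ _ _ _ uG.
have Qf : even_fixed T_tree f' aX aT (multihom_of f') by exact: even_fixed_hom.
have Kf' : order_complex (multihom_le G' H') (equiv_multihom f v pG v' pH w')
    [set multihom_of f'].
  split=> [||_ ->|_ _ -> ->];
    [exact: finite_set1|by exists (multihom_of f')|by case: Qf|by left => x].
exists Kf'.
apply: (component_contractible (Q := even_fixed T_tree f' aX aT) R Kf' _ _
   (@multihom_le_trans G' H') (@multihom_le_anti G' H')
   (chi := retract T_tree f' aX aT orbs) (up := fun n => ~~ odd n)).
- exact: Qf.
- by move=> eta theta; exact: even_fixed_closed.
- move=> n eta; exact: retract_equivariant.
- move=> n eta theta; exact: retract_mono.
- move=> n eta _; exact: retract_step.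
- exact: retract_stable.
- exact: retract_start.
Qed.
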